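(* There is an absolute constant $C>0$ such that the following holds for every integer $n\ge 2$. Let $S\subset\mathbb{R}$ be a set of $n$ servers and let $r_1,\dots,r_n\in\mathbb{R}$ be a sequence of $n$ requests on the line, arriving in this order, with cost $d(s,r)=|s-r|$. Let $M$ be the online matching produced by the RM-Algorithm with parameter $t=3$ on this input, and let $M_{\mathrm{Opt}}$ be a minimum-cost perfect matching of $S$ and $R=\{r_1,\dots,r_n\}$. Then $$w(M)\le C\,\log n\cdot w(M_{\mathrm{Opt}}).$$ That is, the (deterministic) RM-Algorithm is $O(\log n)$-competitive for online bipartite matching on the line in the adversarial model.
   Context: A matching is a set of vertex-disjoint edges of the complete bipartite graph between servers and requests; its cost is $w(M)=\sum_{(s,r)\in M}d(s,r)$. In the online problem requests arrive one at a time and each must be matched immediately and irrevocably to a currently unmatched server. Given a matching $M^*$, a vertex not matched by $M^*$ is free; an augmenting path with respect to $M^*$ is a simple path between two free vertices whose edges alternate between edges not in $M^*$ and edges in $M^*$. For a parameter $t\ge 1$ the $t$-net-cost of an augmenting path $P$ with respect to $M^*$ is $$\phi_t(P)=t\sum_{(s,r)\in P\setminus M^*}d(s,r)-\sum_{(s,r)\in P\cap M^*}d(s,r).$$ RM-Algorithm (parameter $t$): it maintains an online matching $M$ and an offline matching $M^*$, both initially empty, which always match the already arrived requests to the same set of servers. When request $r_i$ arrives: (1) compute an augmenting path $P_i$ of minimum $t$-net-cost with respect to the current $M^*$, starting at $r_i$ and ending at some free server $s_i$; among paths of the same minimum $t$-net-cost choose one with the fewest edges; (2) replace $M^*$ by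 the symmetric difference $M^*\oplus P_i$ and add the edge $(s_i,r_i)$ to $M$. *)

(* Defs.v *)
From mathcomp Require Import all_boot all_order all_algebra.
From mathcomp Require Import reals exp.

Set Implicit Arguments.
Unset Strict Implicit.
Unset Printing Implicit Defensive.

Import Order.TTheory GRing.Theory Num.Theory.
Local Open Scope ring_scope.

Section BipartiteMatching.
Variables srv req : finType.

(* The complete bipartite graph between servers and requests; the sum type
   keeps a server and a request apart even when they have the same location. *)
Definition vertex : finType := (srv + req)%type.
Definition edge : finType := (srv * req)%type.

Definition edge_between (u v : vertex) : option edge :=
  match u, v with
  | inl s, inr r | inr r, inl s => Some (s, r)
  | _, _ => None
  end.

Definition adjacent : rel vertex := fun u v => edge_between u v != None.

Definition incident (e : edge) (v : vertex) : bool :=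
  (v == inl e.1) || (v == inr e.2).

Definition covered (M : {set edge}) (v : vertex) : bool :=
  [exists e in M, incident e v].

Definition free (M : {set edge}) (v : vertex) : bool := ~~ covered M v.

Definition matching (M : {set edge}) : Prop :=
  forall e f v, e \in M -> f \in M -> incident e v -> incident f v -> e = f.

Definition perfect_matching (M : {set edge}) : Prop :=
  matching M /\ forall v, covered M v.

(* A path is given, as in path.v, by its first vertex u and the sequence p of
   its further vertices. *)
Definition path_edges (u : vertex) (p : seq vertex) : seq edge :=
  pmap id (pairmap edge_between u p).

Definition path_edge_set (u : vertex) (p : seq vertex) : {set edge} :=
  [set e in path_edges u p].

Definition simple_path (u : vertex) (p : seq vertex) : bool :=
  path adjacent u p && uniq (u :: p).

Definition alternating (M : {set edge}) (u : vertex) (p : seq vertex) : bool :=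
  sorted (fun e f => (e \in M) != (f \in M)) (path_edges u p).

Definition augmenting_path (M : {set edge}) (u : vertex) (p : seq vertex)
    : Prop :=
  [/\ simple_path u p, u != last u p, free M u, free M (last u p)
    & alternating M u p].

Definition symdiff (A B : {set edge}) : {set edge} :=
  (A :\: B) :|: (B :\: A).

Variables (R : realType) (d : edge -> R).

Definition cost (M : {set edge}) : R := \sum_(e in M) d e.

Definition min_cost_perfect_matching (M : {set edge}) : Prop :=
  perfect_matching M /\
  forall M', perfect_matching M' -> cost M <= cost M'.

Definition net_cost (t : R) (M P : {set edge}) : R :=
  t * (\sum_(e in P :\: M) d e) - \sum_(e in P :&: M) d e.

Definition augmenting_path_from_to (M : {set edge}) (r : req) (s : srv)
    (p : seq vertex) : Prop :=
  augmenting_path M (inr r) p /\ last (inr r) p = inl s.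

(* The end server is not prescribed: the competitors p' may end at any free
   server.  Remaining ties are left open, so any choice is admissible. *)
Definition rm_choice (t : R) (M : {set edge}) (r : req) (s : srv)
    (p : seq vertex) : Prop :=
  let P := path_edge_set (inr r) p in
  augmenting_path_from_to M r s p /\
  forall s' p', augmenting_path_from_to M r s' p' ->
    let P' := path_edge_set (inr r) p' in
    net_cost t M P <= net_cost t M P' /\
    (net_cost t M P' = net_cost t M P -> (#|P| <= #|P'|)%N).

(* rm_run t rs M Mstar: after the arrival of the requests rs, in this order,
   M and Mstar are possible values of the online and the offline matching. *)
Inductive rm_run (t : R) : seq req -> {set edge} -> {set edge} -> Prop :=
| rm_run_start : rm_run t [::] set0 set0
| rm_run_arrival rs M Mstar r s p :
    rm_run t rs M Mstar -> rm_choice t Mstar r s p ->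
    rm_run t (rcons rs r) ((s, r) |: M)
      (symdiff Mstar (path_edge_set (inr r) p)).

End BipartiteMatching.

Definition line_cost (R : realType) (n : nat) (s r : 'I_n -> R)
    (e : edge 'I_n 'I_n) : R := `|s e.1 - r e.2|.

(* Main.v *)
Require Import Defs.
From mathcomp Require Import all_boot all_order all_algebra.
From mathcomp Require Import reals exp.
From mathcomp Require Import ring lra zify.
Import Order.TTheory GRing.Theory Num.Theory.
Local Open Scope ring_scope.

Set Implicit Arguments.
Unset Strict Implicit.
Unset Printing Implicit Defensive.

(** Write [phi i] for the net cost of the [i]-th augmenting path and [c i] for
the cost of the [i]-th online edge. As [t = 3], [phi i] is the length of the
path plus twice the change of the weight of [M*], so the [c i] sum to at most
the sum of the [phi i], and it suffices to bound the "short" edges, those with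
[c i <= 2 * phi i].

On the line neither an augmenting path nor an edge of [M*] jumps over a free
server. Hence the line splits into gaps between consecutive free servers, each
gap is balanced, a request is matched to an end of its gap, and gaps only
merge. Shortest-path potentials vanish at the ends of a gap, so potentials of
disjoint gaps taken at different times glue to one dual solution: the weights
of [M*] inside disjoint gaps, plus the net costs of the next paths there, sum
to at most [3 * w(M_Opt)].

Fix a scale [D] and the requests whose gap has length in [[D, 25/24 * D)]. For
a 1-Lipschitz function [u], the sum of [u s_i - u r_i] over the requests of
this scale is the difference of two balanced sums, hence bounded by the weight
of [M*] in disjoint gaps, i.e. by [O(w(M_Opt))]. Within a maximal gap of the
scale, take the first gap [(A, B)]; later online edges end outside it. With
[u] the distance to the middle of [(A, B)], edges shorter than [D / 2]
contribute exactly their cost; with [u] the distance to the complement of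
[(A, B)], all contributions have the same sign and long ones are controlled,
because a large [phi i] keeps free servers away from the request. So the
short edges of each of the [O(log n)] relevant scales cost [O(w(M_Opt))] plus a
small fraction of all edges of that scale. *)

(** * Alternating walks, potentials and augmentation *)

(** Duplicate-free sequences over a finite type have bounded length, so only finitely many
    compete. *)
Lemma uniq_argmin (R : realDomainType) (T : finType) (P : pred (seq T))
    (f : seq T -> R) (l : seq T) :
  uniq l -> P l ->
  exists l0, [/\ uniq l0, P l0 &
    forall l', uniq l' -> P l' -> f l0 <= f l'].
Proof.
move=> ul Pl.
have sz (k : seq T) : uniq k -> (size k <= #|T|)%N.
  by move=> uk; rewrite -(card_uniqP uk) max_card.
pose b0 : #|T|.-bseq T := Bseq (sz _ ul).
pose Q (b : #|T|.-bseq T) := uniq b && P b.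
have Qb0 : Q b0 by rewrite /Q /= ul.
case: (arg_minP (fun b : #|T|.-bseq T => f b) Qb0) => b /andP[ub Pb] min.
exists b; split=> // l' ul' Pl'.
by have := min (Bseq (sz _ ul')); rewrite /Q /= ul' Pl'; apply.
Qed.

Section Alternating.
Variables (srv req : finType) (R : realFieldType) (d : srv -> req -> R).
Hypothesis d_ge0 : forall s y, 0 <= d s y.

Implicit Types (mt : srv -> option req) (l : seq srv) (s : srv) (x y : req).

Definition partial_inj mt :=
  forall s s' y, mt s = Some y -> mt s' = Some y -> s = s'.

(* An augmenting path starting at a request is encoded by the list of its
   servers: all but the last one are matched, and the requests in between are
   their partners. *)
Fixpoint alist mt l : bool :=
  if l is s :: l' then (if mt s is Some _ then alist mt l' else l' == [::])
  else false.

Fixpoint walk_cost mt x l : R :=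
  if l is s :: l' then
    3 * d s x + (if mt s is Some y then walk_cost mt y l' - d s y else 0)
  else 0.

Fixpoint walk_length mt x l : R :=
  if l is s :: l' then
    d s x + (if mt s is Some y then d s y + walk_length mt y l' else 0)
  else 0.

Fixpoint augment mt x l : srv -> option req :=
  if l is s0 :: l' then fun s =>
    if s == s0 then Some x
    else if mt s0 is Some y then augment mt y l' s else mt s
  else mt.

Definition pcost (o : option req) s : R := if o is Some y then d s y else 0.

Definition weight mt : R := \sum_s pcost (mt s) s.

Definition potential mt (psi : srv -> R) :=
  [/\ forall s, 0 <= psi s, forall s, mt s = None -> psi s = 0 &
      forall s s' y, mt s = Some y -> psi s + d s y <= psi s' + 3 * d s' y].

Lemma pcost_ge0 o s : 0 <= pcost o s.
Proof. by case: o => /=. Qed.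

Lemma alist_last mt s l : alist mt (s :: l) -> mt (last s l) = None.
Proof.
elim: l s => [|s' l IH] s /=; first by case: (mt s).
by case: (mt s) => // _ /IH.
Qed.

(** The dual constraints telescope along the walk, which ends at a free server of potential 0; [z]
    is a feasible dual value for [x]. *)
Lemma walk_cost_ge mt psi x z l : potential mt psi ->
  (forall s, z <= psi s + 3 * d s x) -> alist mt l -> z <= walk_cost mt x l.
Proof.
case=> p0 pf pm; elim: l x z => [//|s l IH] x z zP /=.
have := zP s; case E: (mt s) => [y|].
  move=> zs /(IH y (psi s + d s y)); move/(_ (fun s' => pm s s' y E)).
  by move: (p0 s) => *; lra.
by move=> + _; rewrite (pf _ E); lra.
Qed.

Lemma walk_cost_cat_ge mt psi x z l1 s y l2 : potential mt psi ->
  (forall s, z <= psi s + 3 * d s x) -> mt s = Some y ->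
  alist mt (l1 ++ s :: l2) ->
  z - psi s - d s y + walk_cost mt y l2 <= walk_cost mt x (l1 ++ s :: l2).
Proof.
move=> pot + ms; case: (pot) => p0 pf pm.
elim: l1 x z => [|s0 l1 IH] x z zP /=.
  by rewrite ms => _; have := zP s; lra.
case E: (mt s0) => [y0|]; last by case: l1 {IH}.
move=> /(IH y0 (psi s0 + d s0 y0)); move/(_ (fun s' => pm s0 s' y0 E)).
by move: (zP s0); lra.
Qed.

Lemma alist_catr mt l1 s l2 : alist mt (l1 ++ s :: l2) -> alist mt (s :: l2).
Proof.
elim: l1 => [//|s0 l1 IH] /=.
by case: (mt s0) => [y /IH //|]; case: l1 {IH}.
Qed.

(** A loop between two visits of [s] can be cut out: by the potential a closed alternating walk has
    nonnegative net cost. *)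
Lemma alist_shorten mt psi l : potential mt psi -> alist mt l ->
  exists l', [/\ uniq l', alist mt l', forall s, s \in l' -> s \in l &
    forall x, walk_cost mt x l' <= walk_cost mt x l].
Proof.
move=> pot; elim: l => [//|s l IH].
case E: (mt s) => [y|] /=; rewrite E; last first.
  by move=> /eqP ->; exists [:: s]; split=> //=; rewrite E.
move=> /IH [l' [ul al sub le]].
case sl: (s \in l'); last first.
  exists (s :: l'); split=> /=; rewrite ?E ?sl //.
    move=> s'; rewrite !inE; case: eqP => //= _; exact: sub.
  by move=> x; have := le y; lra.
case: (path.splitPr sl) ul al sub le => l1 l2 ul al sub le.
have := al => /alist_catr /= als; rewrite E in als.
exists (s :: l2); split.
- by move: ul; rewrite cat_uniq => /and3P[].
- by rewrite /= E.
- move=> s'; rewrite !inE; case: eqP => //= _ s'l.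
  by apply: sub; rewrite mem_cat inE s'l !orbT.
- move=> x /=; rewrite E.
  have := walk_cost_cat_ge pot (fun s' => (let: And3 _ _ pm := pot in pm s s' y E)) E al.
  by have := le y; lra.
Qed.

(** Minimality ranges over all walks, also non-simple ones, so that tails of optimal walks are
    optimal. *)
Definition is_opt mt x l :=
  [/\ uniq l, alist mt l &
    forall l', alist mt l' -> walk_cost mt x l <= walk_cost mt x l'].

Lemma is_optP mt psi x l : potential mt psi -> uniq l -> alist mt l ->
  (forall l', uniq l' -> alist mt l' -> walk_cost mt x l <= walk_cost mt x l') ->
  is_opt mt x l.
Proof.
move=> pot ul al min; split=> // l' al'.
have [l2 [u2 a2 _ le2]] := alist_shorten pot al'.
exact: le_trans (min _ u2 a2) (le2 x).
Qed.

Lemma is_opt_exists mt psi x f : potential mt psi -> mt f = None ->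
  exists l, is_opt mt x l.
Proof.
move=> pot ff.
have [||l [ul al min]] := @uniq_argmin _ _ (alist mt) (walk_cost mt x) [:: f].
- by [].
- by rewrite /= ff.
by exists l; apply: is_optP pot ul al min.
Qed.

(** Comparison with the direct walk to [f]: whatever follows the first edge has net cost at least
    [psi s >= 0]. *)
Lemma is_opt_edge_le mt psi x l : potential mt psi -> is_opt mt x l ->
  forall s l', l = s :: l' -> forall f, mt f = None -> d s x <= d f x.
Proof.
move=> pot [_ al min] s l' E f ff.
have := min [:: f]; rewrite /= ff => /(_ isT).
rewrite E /=; move: al; rewrite E /=.
case Es: (mt s) => [y|]; last by lra.
case: (pot) => p0 pf pm.
move=> /(walk_cost_ge pot (fun s' => pm s s' y Es)); have := p0 s; lra.
Qed.

Lemma is_opt_tail mt x s y l : is_opt mt x (s :: l) -> mt s = Some y ->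
  is_opt mt y l.
Proof.
move=> [/= /andP[_ ul]]; case E: (mt s) => [y'|//] al min [yy]; subst y'.
split=> // l' al'.
by have := min (s :: l'); rewrite /= E => /(_ al'); lra.
Qed.

(* The cost of completing an alternating walk from s, minimised over all
   walks; this is the potential that survives an augmentation. *)
Lemma eager_potential mt psi f0 : potential mt psi -> mt f0 = None ->
  exists psi', potential mt psi' /\
    (forall x l, is_opt mt x l -> forall s, walk_cost mt x l <= psi' s + 3 * d s x) /\
    (forall s y l, mt s = Some y -> is_opt mt y l ->
       psi' s + d s y = walk_cost mt y l).
Proof.
move=> pot f0f.
have opt_ex s : exists v, forall y, mt s = Some y ->
    exists2 l, is_opt mt y l & v = walk_cost mt y l - d s y.
  case E: (mt s) => [y|]; last by exists 0.
  have [l lP] := is_opt_exists y pot f0f.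
  by exists (walk_cost mt y l - d s y) => _ [<-]; exists l.
have [v vP] := fin_all_exists opt_ex.
pose psi' s := if mt s is Some _ then v s else 0.
have uni y l1 l2 : is_opt mt y l1 -> is_opt mt y l2 ->
    walk_cost mt y l1 = walk_cost mt y l2.
  move=> [_ a1 m1] [_ a2 m2]; apply/eqP.
  by rewrite eq_le m1 // m2.
have psiE s y l : mt s = Some y -> is_opt mt y l ->
    psi' s + d s y = walk_cost mt y l.
  move=> E ol; rewrite /psi' E; have [l' ol' ->] := vP s y E.
  by rewrite (uni _ _ _ ol ol'); lra.
have P3 x l : is_opt mt x l -> forall s, walk_cost mt x l <= psi' s + 3 * d s x.
  move=> [_ al min] s; rewrite /psi'; case E: (mt s) => [y|].
    have [l' [_ al' _] ->] := vP s y E.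
    by have := min (s :: l'); rewrite /= E => /(_ al'); lra.
  by have := min [:: s]; rewrite /= E => /(_ isT); lra.
exists psi'; split; last by split.
split.
- move=> s; rewrite /psi'; case E: (mt s) => [y|//].
  have [l' [_ al' _] ->] := vP s y E.
  case: (pot) => p0 pf pm.
  have := walk_cost_ge pot (fun s' => pm s s' y E) al'; have := p0 s; lra.
- by move=> s; rewrite /psi' => ->.
- move=> s s' y E; have [l ol] := is_opt_exists y pot f0f.
  by rewrite (psiE s y l) //; apply: P3.
Qed.

Lemma augment_notin mt x l s : s \notin l -> augment mt x l s = mt s.
Proof.
elim: l x => [//|s0 l IH] x /=; rewrite inE negb_or => /andP[/negPf -> nl].
by case: (mt s0) => // y; apply: IH.
Qed.

(** A server on the walk attains the minimum of [psi' s + 3 * d s x] for its new partner [x]; the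
    new edge enters the constraint only as [d s x], so it has slack. *)
Lemma augment_potential mt psi' x l : potential mt psi' ->
  (forall x l, is_opt mt x l -> forall s, walk_cost mt x l <= psi' s + 3 * d s x) ->
  (forall s y l, mt s = Some y -> is_opt mt y l ->
       psi' s + d s y = walk_cost mt y l) ->
  is_opt mt x l -> potential (augment mt x l) psi'.
Proof.
case=> p0 pf pm P3 psiE ol; split=> //.
  move=> s; case sl: (s \in l); last by rewrite augment_notin ?sl // => /pf.
  elim: l x {ol} sl => [//|s0 l IH] x; rewrite inE /=.
  case: eqP => [//|/= _] sl; case E: (mt s0) => [y|]; last exact: pf.
  exact: IH.
move=> s s' y.
elim: l x ol => [x _|s0 l IH x ol] /=; first exact: pm.
case: eqP => [-> [<-]|_]; last first.
  case E: (mt s0) => [y0|]; last exact: pm.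
  exact/IH/(is_opt_tail ol E).
have := P3 _ _ ol s'; rewrite /=.
case E: (mt s0) => [y0|].
  have := psiE _ _ _ E (is_opt_tail ol E); have := d_ge0 s0 x; lra.
rewrite (pf _ E); have := d_ge0 s0 x; lra.
Qed.

Lemma augment_neq mt x z l s : x != z -> mt s <> Some z ->
  (forall s', s' \in l -> mt s' <> Some z) -> augment mt x l s <> Some z.
Proof.
elim: l x => [//|s0 l IH] x xz sz lz /=.
case: eqP => [_ [xz']|_]; first by rewrite xz' eqxx in xz.
case E: (mt s0) => [y|//]; apply: IH => //.
- by apply/eqP => yz; apply: (lz s0); rewrite ?mem_head // E yz.
- by move=> s' s'l; apply: lz; rewrite inE s'l orbT.
Qed.

(** After the first step the moving request is still matched in [mt], to the server just passed.
    Hence freshness of [x] is demanded only at [l], [s] and [s']. *)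
Lemma augment_inj_in mt x l s s' z : partial_inj mt -> uniq l ->
  (forall s1, s1 \in l -> mt s1 <> Some x) ->
  mt s <> Some x -> mt s' <> Some x ->
  augment mt x l s = Some z -> augment mt x l s' = Some z -> s = s'.
Proof.
move=> inj; elim: l x s s' => [|s0 l IH] x s s' /=.
  by move=> _ _ _ _; apply: inj.
move=> /andP[s0l ul] lx sx s'x.
have lx' s1 : s1 \in l -> mt s1 <> Some x.
  by move=> s1l; apply: lx; rewrite inE s1l orbT.
have main s1 : s1 != s0 -> mt s1 <> Some x ->
    (if mt s0 is Some y then augment mt y l s1 else mt s1) <> Some x.
  move=> s10 s1x; case E: (mt s0) => [y|//]; apply: augment_neq => //.
  by apply/eqP => yx; apply: (lx s0); rewrite ?mem_head // E yx.
case: (eqVneq s s0) => [-> [<-]|ns]; case: (eqVneq s' s0) => [-> //|ns'].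
- by move=> /(main _ ns' s'x).
- by move=> + [zx]; rewrite -zx => /(main _ ns sx).
case E: (mt s0) => [y|]; last exact: inj.
apply: IH => // [s1 s1l E1||] .
- by move: s0l; rewrite (inj _ _ _ E E1) s1l.
- by move=> E1; move: ns; rewrite (inj _ _ _ E E1) eqxx.
- by move=> E1; move: ns'; rewrite (inj _ _ _ E E1) eqxx.
Qed.

Lemma augment_inj mt x l : partial_inj mt -> uniq l ->
  (forall s, mt s <> Some x) -> partial_inj (augment mt x l).
Proof. by move=> inj ul nx s s' z; apply: augment_inj_in => // s1 _. Qed.

Lemma augment_free mt x l s : alist mt l ->
  augment mt x l s = None <-> mt s = None /\ s != last s l.
Proof.
move=> al0; have gen l1 x1 s1 : alist mt (s1 :: l1) -> forall s,
   augment mt x1 (s1 :: l1) s = None <-> mt s = None /\ s != last s1 l1.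
  elim: l1 x1 s1 => [|s2 l1 IH] x1 s1; rewrite /= => al s3.
    case E: (mt s1) al => [//|] _; case: eqP => [->|_]; last by split=> [|[]].
    by rewrite E; split => // -[].
  case E: (mt s1) al => [y|//] /(IH y) {}IH.
  case: eqP => [->|_]; last exact: IH.
  by rewrite E; split => // -[].
by case: l al0 => [//|s1 l] al; apply: gen.
Qed.

Lemma augment_Some mt x l s y : augment mt x l s = Some y ->
  y = x \/ exists s', mt s' = Some y.
Proof.
elim: l x => [|s0 l IH] x /=; first by right; exists s.
case: eqP => [_ [<-]|_]; first by left.
case E: (mt s0) => [z|]; last by right; exists s.
by move=> /IH [->|]; [right; exists s0|right].
Qed.

(** With [a] and [b] the total lengths of the new and the removed edges, this is
    [3a - b = (a + b) + 2(a - b)]. *)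
Lemma weight_augment mt x l : uniq l -> alist mt l ->
  walk_cost mt x l = walk_length mt x l + 2 * (weight (augment mt x l) - weight mt).
Proof.
elim: l x => [//|s0 l IH] x /= /andP[s0l ul].
have step g : weight (fun s => if s == s0 then Some x else g s)
    = d s0 x + weight g - pcost (g s0) s0.
  rewrite /weight (bigD1 s0) //= [in RHS](bigD1 s0) //= eqxx /=.
  rewrite (eq_bigr (fun s => pcost (g s) s)); first by lra.
  by move=> s /negPf ->.
case E: (mt s0) => [y|] al.
  by rewrite (step (augment mt y l)) augment_notin // E /= IH //; lra.
by rewrite (step mt) E /=; lra.
Qed.

(** In the same notation, [a + b = (3a - b) / 3 + (4 / 3) b]. *)
Lemma walk_length_eq mt x l : uniq l -> alist mt l ->
  walk_length mt x l = walk_cost mt x l / 3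
    + (4 / 3) * \sum_(s in l) pcost (mt s) s.
Proof.
move=> ul al; rewrite -big_uniq //= {ul}; elim: l x al => [//|s0 l IH] x /=.
rewrite big_cons; case E: (mt s0) => [y|] /=; first by move=> /IH ->; lra.
by move=> /eqP ->; rewrite big_nil; lra.
Qed.

End Alternating.

(** * Augmenting paths as lists of servers *)

Section AugmentingPaths.
Variables (srv req : finType).
Implicit Types (mt : srv -> option req) (l : seq srv) (s : srv) (x y : req).

Definition graph_of mt : {set edge srv req} := [set e | mt e.1 == Some e.2].

Fixpoint path_of mt l : seq (vertex srv req) :=
  if l is s :: l' then
    inl s :: (if mt s is Some y then inr y :: path_of mt l' else [::])
  else [::].

Fixpoint edges_of mt x l : seq (edge srv req) :=
  if l is s :: l' then
    (s, x) :: (if mt s is Some y then (s, y) :: edges_of mt y l' else [::])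
  else [::].

Lemma mem_graph mt s y : ((s, y) \in graph_of mt) = (mt s == Some y).
Proof. by rewrite inE. Qed.

Lemma free_srvE mt s : Defs.free (graph_of mt) (inl s) = (mt s == None).
Proof.
apply/negP/eqP => [nc|E /existsP[[s' y] /andP[]]].
  case E: (mt s) => [y|//]; case: nc; apply/existsP; exists (s, y).
  by rewrite mem_graph E eqxx /incident eqxx.
by rewrite mem_graph /incident /= orbF => Es /eqP[ss]; move: Es; rewrite -ss E.
Qed.

Lemma free_reqP mt x :
  Defs.free (graph_of mt) (inr x) <-> forall s, mt s <> Some x.
Proof.
split=> [/negP nc s E|nx].
  apply: nc; apply/existsP; exists (s, x).
  by rewrite mem_graph E eqxx /incident /= eqxx.
apply/negP => /existsP[[s y] /andP[]].
by rewrite mem_graph /incident /= => /eqP E /eqP[xy]; apply: (nx s); rewrite E xy.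
Qed.

Lemma path_edges_cons (u v : vertex srv req) p :
  path_edges u (v :: p) =
  if edge_between u v is Some e then e :: path_edges v p else path_edges v p.
Proof. by rewrite /path_edges /=; case: (edge_between u v). Qed.

Lemma path_edges_of mt x l : path_edges (inr x) (path_of mt l) = edges_of mt x l.
Proof.
elim: l x => [//|s l IH] x /=; rewrite path_edges_cons /=.
case: (mt s) => [y|//]; by rewrite path_edges_cons /= IH.
Qed.

Lemma last_path_of mt l x s0 : alist mt l ->
  last (inr x) (path_of mt l) = inl (last s0 l).
Proof.
elim: l x s0 => [//|s l IH] x s0 /=.
by case: (mt s) => [y al|/eqP -> //] /=; apply: IH.
Qed.

Lemma mem_path_of_srv mt l s : alist mt l ->
  (inl s \in path_of mt l) = (s \in l).
Proof.
elim: l => [//|s0 l IH] /=; rewrite !inE.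
by case: (mt s0) => [y al|/eqP -> //]; rewrite inE /= IH.
Qed.

Lemma mem_path_of_req mt l y : inr y \in path_of mt l ->
  exists2 s, s \in l & mt s = Some y.
Proof.
elim: l => [//|s0 l IH] /=; rewrite inE /=.
case E: (mt s0) => [z|//]; rewrite inE /= => /orP[/eqP[->]|/IH[s sl Es]].
  by exists s0; rewrite ?mem_head.
by exists s; rewrite ?inE ?sl ?orbT.
Qed.

(** The induction removes a server and its partner at once. That the first edge is unmatched stands
    in for freeness of [x], which fails at the later requests. *)
Lemma path_of_alist mt (p : seq (vertex srv req)) x f :
  path (@adjacent srv req) (inr x) p ->
  sorted (fun e e' => (e \in graph_of mt) != (e' \in graph_of mt))
    (path_edges (inr x) p) ->
  (if path_edges (inr x) p is e :: _ then e \notin graph_of mt else true) ->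
  last (inr x) p = inl f -> mt f = None ->
  exists l, [/\ alist mt l, p = path_of mt l & last f l = f].
Proof.
have [m] := ubnP (size p); elim: m x p => // m IH x [//|v p].
rewrite ltnS; case: v => [s|y] szp /andP[] // _.
rewrite path_edges_cons [edge_between _ _]/=.
case: p szp => [|v p] szp.
  by move=> _ _ _ [->] Ef; exists [:: f]; rewrite /= Ef.
case/andP; case: v szp => [//|y] szp _ pth.
rewrite path_edges_cons [edge_between _ _]/=.
move=> /andP[ne so] n1; rewrite (negPf n1) mem_graph in ne.
have Es : mt s = Some y by apply/eqP; move: ne; case: (mt s == _).
move=> lst Ef.
have [||||||l [al -> lf]] := IH y p => //.
- by move: szp; rewrite /= ; lia.
- exact: path_sorted so.
- move: so; case: (path_edges _ _) => //= e es /andP[+ _].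
  by rewrite mem_graph Es eqxx; case: (e \in _).
exists (s :: l); rewrite /= Es; split=> //.
by case: l al lf.
Qed.

Lemma augmenting_alist mt x f p :
  augmenting_path_from_to (graph_of mt) x f p ->
  [/\ forall s, mt s <> Some x, mt f = None &
   exists l, [/\ uniq l, alist mt l, p = path_of mt l & last f l = f]].
Proof.
case=> -[/andP[pth un] _ /free_reqP nx + alt] lst; rewrite lst free_srvE.
move=> /eqP Ef; split=> //.
have [|l [al pl lf]] := path_of_alist pth alt _ lst Ef.
  case: p pth {un alt lst} => [//|[s|y] p] // _.
  rewrite path_edges_cons; change ((s, x) \notin graph_of mt).
  by rewrite mem_graph; apply/eqP/nx.
exists l; split=> //.
move: un => /= /andP[_]; rewrite pl => {pl lf}.
elim: l al => [//|s l IH] /=; case E: (mt s) => [y|]; last by move=> /eqP ->.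
move=> al; rewrite /= inE /= mem_path_of_srv // => /andP[-> /andP[_ u]].
by rewrite IH.
Qed.

Lemma sorted_edges_of mt x l : partial_inj mt -> uniq l -> alist mt l ->
  (forall s, s \in l -> mt s <> Some x) ->
  sorted (fun e e' => (e \in graph_of mt) != (e' \in graph_of mt))
    (edges_of mt x l).
Proof.
move=> inj; elim: l x => [//|s l IH] x /= /andP[sl ul].
case E: (mt s) => [y|//] al nx /=.
have nsx : mt s != Some x by apply/eqP; apply: nx; rewrite mem_head.
have ny s' : s' \in l -> mt s' <> Some y.
  by move=> s'l E'; move: sl; rewrite (inj _ _ _ E E') s'l.
rewrite !mem_graph (negPf nsx) E eqxx /=.
have := IH y ul al ny.
case: l al sl ul ny {IH nx} => [//|s' l] al sl ul ny /=.
rewrite mem_graph E eqxx mem_graph.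
suff -> : mt s' == Some y = false by [].
by apply/eqP; apply: ny; rewrite mem_head.
Qed.

Lemma alist_augmenting mt x l f : partial_inj mt ->
  (forall s, mt s <> Some x) -> uniq l -> alist mt l -> last f l = f ->
  augmenting_path_from_to (graph_of mt) x f (path_of mt l).
Proof.
move=> inj nx ul al lf.
have lst := last_path_of x f al; rewrite lf in lst.
split=> //; split.
- apply/andP; split.
    elim: l x al {ul lf nx lst} => [//|s l IH] x /=.
    by case: (mt s) => [y|//] al; apply: IH.
  rewrite /=; apply/andP; split.
    by apply/negP => /mem_path_of_req[s _ /nx].
  elim: l al ul {lf lst} => [//|s l IH] /= + /andP[sl ul].
  case E: (mt s) => [y|//] al; rewrite /= inE /= mem_path_of_srv // sl IH //.
  rewrite andbT; apply/negP => /mem_path_of_req[s' s'l E'].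
  by move: sl; rewrite (inj _ _ _ E E') s'l.
- by rewrite lst.
- exact/free_reqP.
- rewrite lst free_srvE; case: l al lf {ul lst} => [//|s l] al /= <-.
  by rewrite (alist_last al).
- rewrite /alternating path_edges_of; apply: sorted_edges_of => // s _; exact: nx.
Qed.

Lemma edges_of_srv mt x l e : e \in edges_of mt x l -> e.1 \in l.
Proof.
elim: l x => [//|s l IH] x /=; rewrite inE => /orP[/eqP ->|].
  by rewrite mem_head.
case: (mt s) => [y|//]; rewrite inE => /orP[/eqP ->|/IH e1]; rewrite ?mem_head //.
by rewrite inE e1 orbT.
Qed.

Lemma uniq_edges_of mt x l : partial_inj mt -> uniq l ->
  (forall s, s \in l -> mt s <> Some x) -> uniq (edges_of mt x l).
Proof.
move=> inj; elim: l x => [//|s l IH] x /= /andP[sl ul] nx.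
case E: (mt s) => [y|//] /=.
have ny s' : s' \in l -> mt s' <> Some y.
  by move=> s'l E'; move: sl; rewrite (inj _ _ _ E E') s'l.
have ns z : (s, z) \notin edges_of mt y l.
  by apply/negP => /edges_of_srv; rewrite (negPf sl).
rewrite inE negb_or !ns IH // !andbT.
apply/eqP => -[xy]; by apply: (nx s); rewrite ?mem_head // E xy.
Qed.

Lemma net_cost_path_of (R : realType) (d : edge srv req -> R) mt x l :
  partial_inj mt -> uniq l -> (forall s, s \in l -> mt s <> Some x) ->
  net_cost d 3 (graph_of mt) (path_edge_set (inr x) (path_of mt l))
  = walk_cost (fun s y => d (s, y)) mt x l.
Proof.
move=> inj ul nx; rewrite /net_cost /path_edge_set path_edges_of.
have ue := uniq_edges_of inj ul nx.
rewrite (eq_bigl (fun e => (e \in edges_of mt x l) && (e \notin graph_of mt))); last first.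
  by move=> e; rewrite !inE andbC.
rewrite [X in _ - X](eq_bigl (fun e => (e \in edges_of mt x l) && (e \in graph_of mt))); last first.
  by move=> e; rewrite !inE.
rewrite !big_mkcondr -!big_uniq //=.
elim: l x ul nx {ue} => [|s l IH] x /=; first by rewrite !big_nil; lra.
move=> /andP[sl ul] nx.
have nsx : mt s == Some x = false by apply/eqP; apply: nx; rewrite mem_head.
rewrite !big_cons !mem_graph nsx /=.
case E: (mt s) => [y|]; last by rewrite !big_nil; lra.
have ny s' : s' \in l -> mt s' <> Some y.
  by move=> s'l E'; move: sl; rewrite (inj _ _ _ E E') s'l.
rewrite !big_cons !mem_graph E eqxx /= -IH //; lra.
Qed.

Lemma symdiff_path_of mt x l : partial_inj mt -> uniq l -> alist mt l ->
  (forall s, s \in l -> mt s <> Some x) ->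
  symdiff (graph_of mt) (path_edge_set (inr x) (path_of mt l))
  = graph_of (augment mt x l).
Proof.
move=> inj ul al nx; apply/setP => -[s z].
rewrite /path_edge_set path_edges_of !inE /=.
elim: l x ul al nx => [|s0 l IH] x /=; first by rewrite andbF.
move=> /andP[sl ul] + nx.
have ns w : s = s0 -> (s, w) \notin edges_of mt (odflt x (mt s0)) l.
  by move=> ->; apply/negP => /edges_of_srv; rewrite (negPf sl).
case E: (mt s0) => [y|] al.
  have ny s' : s' \in l -> mt s' <> Some y.
    by move=> s'l E'; move: sl; rewrite (inj _ _ _ E E') s'l.
  have := IH y ul al ny.
  rewrite !inE !xpair_eqE.
  case: (eqVneq s s0) => [ss0 /= _|/= ns0 <- //].
  rewrite E /= in ns; rewrite (negPf (ns z ss0)) orbF ss0 E.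
  have xy : y != x by apply/eqP => yx; apply: (nx s0); rewrite ?mem_head // E yx.
  rewrite (_ : (Some y == Some z) = (z == y)); last by rewrite eq_sym.
  rewrite (_ : (Some x == Some z) = (z == x)); last by rewrite eq_sym.
  case: (eqVneq z y) => [->|]; rewrite ?(negPf xy) ?orbF ?andbF ?andbT //=.
rewrite !inE !xpair_eqE.
case: (eqVneq s s0) => [->|] /=; last by rewrite andbF orbF.
by rewrite E /= andbF /= eq_sym.
Qed.

(** Every duplicate-free walk encodes an augmenting path, so the chosen path is optimal among these,
    hence among all walks by [is_optP]. *)
Lemma rm_choice_alist (R : realType) (d : edge srv req -> R) mt x f p psi :
  (forall e, 0 <= d e) ->
  partial_inj mt -> potential (fun s y => d (s, y)) mt psi ->
  rm_choice d 3 (graph_of mt) x f p ->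
  [/\ forall s, mt s <> Some x, mt f = None &
   exists l, [/\ is_opt (fun s y => d (s, y)) mt x l, last f l = f &
     symdiff (graph_of mt) (path_edge_set (inr x) p) = graph_of (augment mt x l)]].
Proof.
move=> d0 inj pot [/= aug min].
have [nx Ef [l [ul al pl lf]]] := augmenting_alist aug.
split=> //; exists l.
have nx' s : s \in l -> mt s <> Some x by move=> _; apply: nx.
split=> //; last by rewrite pl symdiff_path_of.
apply: (is_optP pot) => // l' ul' al'.
have aug' : augmenting_path_from_to (graph_of mt) x (last f l') (path_of mt l').
  by apply: alist_augmenting => //; case: l' al' {ul'}.
have [+ _] := min _ _ aug'.
by rewrite pl !net_cost_path_of.
Qed.

End AugmentingPaths.

(** * Runs of the algorithm on the line *)

Section Side.
Variable R : realFieldType.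
Implicit Types a b c : R.

Definition same_side c a b := ((a < c) == (b < c)) && ((c < a) == (c < b)).

Lemma same_side_refl c a : same_side c a a.
Proof. by rewrite /same_side !eqxx. Qed.

Lemma same_side_sym c a b : same_side c a b = same_side c b a.
Proof. by rewrite /same_side eq_sym [X in _ && X]eq_sym. Qed.

Lemma same_side_trans c b a1 a2 :
  same_side c a1 b -> same_side c b a2 -> same_side c a1 a2.
Proof. by rewrite /same_side => /andP[/eqP -> /eqP ->]. Qed.

Lemma near_same_side c a b : a != c -> `|a - b| <= `|c - b| -> same_side c a b.
Proof.
rewrite /same_side => ac; case: (ltgtP b c) => [bc|cb|->].
- have -> : `|c - b| = c - b by rewrite ger0_norm // subr_ge0 ltW.
  move=> ab; have ac' : a <= c by have := ler_norm (a - b); lra.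
  have {}ac : a < c by rewrite lt_neqAle ac.
  by rewrite ac ltNge (ltW ac).
- have -> : `|c - b| = - (c - b) by rewrite ler0_norm // subr_le0 ltW.
  move=> ab; have ac' : c <= a by have := ler_norm (- (a - b)); rewrite normrN; lra.
  have {}ac : c < a by rewrite lt_neqAle eq_sym ac.
  by rewrite ac ltNge (ltW ac).
- by rewrite subrr normr0 normr_le0 subr_eq0 (negPf ac).
Qed.

End Side.

Section Line.
Variables (srv req : finType) (R : realType) (sp : srv -> R) (rp : req -> R).
Hypothesis sp_inj : injective sp.
Implicit Types (mt : srv -> option req) (l : seq srv) (s f : srv) (x y : req).

Definition dist s y : R := `|sp s - rp y|.

Lemma dist_ge0 s y : 0 <= dist s y.
Proof. exact: normr_ge0. Qed.

(** The invariant that keeps offline edges from jumping over a free server. *)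
Definition near mt :=
  forall s y f, mt s = Some y -> mt f = None -> dist s y <= dist f y.

(** The default [x] counts every free server as inside; such a server adds 0 to [local_weight]. *)
Definition inside mt x s : bool :=
  [forall f, (mt f == None) ==> same_side (sp f) (rp (odflt x (mt s))) (rp x)].

Definition local_weight mt x : R := \sum_(s | inside mt x s) pcost dist (mt s) s.

Record event mt x f (phi : R) (psi : srv -> R) : Prop := Event {
  event_pot : potential dist mt psi;
  event_near : near mt;
  event_ge0 : 0 <= phi;
  event_le : forall s, phi <= psi s + 3 * dist s x;
  event_sideR : forall f', mt f' = None -> rp x <= sp f' -> sp f <= sp f';
  event_sideL : forall f', mt f' = None -> sp f' <= rp x -> sp f' <= sp f;
  event_cost : dist f x <= 4 / 3 * (local_weight mt x + phi)
}.

(** An unmatched leg is no longer than the way to [f] by [is_opt_edge_le], a matched leg by [near].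
    Neither can pass [f], so the whole walk stays on one side. *)
Lemma is_opt_side mt psi x l f s0 : potential dist mt psi -> near mt ->
  is_opt dist mt x l -> mt f = None ->
  [/\ rp x <= sp f -> sp (last s0 l) <= sp f,
      sp f <= rp x -> sp f <= sp (last s0 l) &
      forall s y, s \in l -> mt s = Some y -> same_side (sp f) (rp y) (rp x)].
Proof.
move=> pot nr + ff; elim: l x s0 => [|s l IH] x s0 ol.
  by case: ol.
have le := is_opt_edge_le pot ol (erefl _) ff.
case E: (mt s) => [y|]; last first.
  have -> : l = [::] by case: ol => _ /=; rewrite E => /eqP.
  rewrite /=; split.
  - move=> xf; move: le; rewrite /dist (ger0_norm (_ : 0 <= sp f - rp x)) ?subr_ge0 //.
    by have := ler_norm (sp s - rp x); lra.
  - move=> xf; move: le; rewrite /dist (ler0_norm (_ : sp f - rp x <= 0)) ?subr_le0 //.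
    by have := ler_norm (- (sp s - rp x)); rewrite normrN; lra.
  - by move=> s' y; rewrite inE => /eqP ->; rewrite E.
have sf : sp s != sp f by apply/eqP => /sp_inj sf; rewrite sf ff in E.
have xs := near_same_side sf le.
have ys := near_same_side sf (nr _ _ _ E ff).
have yx : same_side (sp f) (rp y) (rp x).
  by apply: same_side_trans xs; rewrite same_side_sym.
have [h1 h2 h3] := IH y s (is_opt_tail ol E).
case/andP: (yx) => /eqP lt1 /eqP lt2; split.
- by rewrite leNgt -lt2 -leNgt.
- by rewrite leNgt -lt1 -leNgt.
- move=> s' y'; rewrite inE => /orP[/eqP ->|s'l E'].
    by rewrite E => -[<-].
  exact: same_side_trans (h3 _ _ s'l E') yx.
Qed.

Lemma augment_near mt psi x l : potential dist mt psi -> near mt ->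
  is_opt dist mt x l -> near (augment mt x l).
Proof.
move=> pot nr ol s y f Es /augment_free; case: (ol) => _ al _.
move=> /(_ al) [ff _] {al}.
elim: l x ol Es => [|s0 l IH] x ol; first by case: ol.
rewrite /=; case: eqP => [-> [<-]|_].
  exact: (is_opt_edge_le pot ol (erefl _) ff).
case E: (mt s0) => [z|]; last by move=> Es; apply: nr Es ff.
exact/IH/(is_opt_tail ol E).
Qed.

Lemma dist_le_walk_length mt x l s0 : alist mt l ->
  dist (last s0 l) x <= walk_length dist mt x l.
Proof.
elim: l x s0 => [//|s l IH] x s0 /=.
case E: (mt s) => [y|]; last by move=> /eqP -> /=; lra.
move=> /(IH y s); rewrite /dist.
set e := sp _ => h.
have := ler_normD (e - rp y) (rp y - rp x).
have := ler_normD (rp y - sp s) (sp s - rp x).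
rewrite [`|rp y - sp s|]distrC.
rewrite (_ : rp y - sp s + (sp s - rp x) = rp y - rp x); last by lra.
rewrite (_ : e - rp y + (rp y - rp x) = e - rp x); last by lra.
lra.
Qed.

Lemma is_opt_event mt psi psi' x l f : potential dist mt psi -> near mt ->
  potential dist mt psi' ->
  (forall x l, is_opt dist mt x l ->
     forall s, walk_cost dist mt x l <= psi' s + 3 * dist s x) ->
  is_opt dist mt x l -> last f l = f ->
  event mt x f (walk_cost dist mt x l) psi'.
Proof.
move=> pot nr pot' P3 ol lf; have [ul al _] := ol.
have phi0 : 0 <= walk_cost dist mt x l.
  apply: (walk_cost_ge pot) => // s; case: (pot) => p0 _ _.
  by have := p0 s; have := dist_ge0 s x; lra.
split=> //.
- exact: P3.
- move=> f' ff' xf'.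
  by have [+ _ _] := is_opt_side f pot nr ol ff'; rewrite lf; apply.
- move=> f' ff' xf'.
  by have [_ + _] := is_opt_side f pot nr ol ff'; rewrite lf; apply.
(* The walk length is a third of the net cost plus 4/3 of its matched edges, and these all lie in
   the gap of [x]. *)
have := dist_le_walk_length x f al; rewrite lf (walk_length_eq _ _ ul al).
suff : \sum_(s in l) pcost dist (mt s) s <= local_weight mt x by lra.
rewrite /local_weight [leRHS](bigID (mem l)) /= -[leLHS]addr0 lerD //.
  rewrite le_eqVlt; apply/orP; left; apply/eqP; apply: eq_bigl => s.
  rewrite andb_idl // => sl; apply/forallP => f'; apply/implyP => /eqP ff'.
  have [_ _] := is_opt_side f pot nr ol ff'.
  case E: (mt s) => [y|] /= side; last exact: same_side_refl.
  exact: side sl E.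
by apply: sumr_ge0 => s _; apply: (pcost_ge0 dist_ge0).
Qed.

Record traced (rs : seq req) (e : req -> srv) (m : req -> srv -> option req)
    (phi : req -> R) (psi : req -> srv -> R) x : Prop := Traced {
  traced_event : event (m x) x (e x) (phi x) (psi x);
  traced_inj : partial_inj (m x);
  traced_free : forall s, (m x s == None) = (s \notin map e rs);
  traced_arrived : forall s y, m x s = Some y -> y \in rs }.

Lemma traced_eq_in rs e e' (m m' : req -> srv -> option req)
    (phi phi' : req -> R) (psi psi' : req -> srv -> R) x :
  {in rs, e =1 e'} -> e x = e' x -> m x = m' x -> phi x = phi' x ->
  psi x = psi' x -> traced rs e m phi psi x -> traced rs e' m' phi' psi' x.
Proof.
move=> /eq_in_map ee ex mx px psx [ev inj fr arr].
by split; rewrite -?ex -?mx -?px -?psx -?ee.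
Qed.

(** Induction on the run. In the cost bound the offline weight telescopes: [phi] is the walk length
    plus twice the change of weight, and the length dominates the online edge. *)
Lemma rm_run_traced (s0 : srv) rs M Mstar : uniq rs ->
  rm_run (fun q => dist q.1 q.2) 3 rs M Mstar ->
  exists (e : req -> srv) (m : req -> srv -> option req)
    (phi : req -> R) (psi : req -> srv -> R) (mtf : srv -> option req),
  [/\ M = [set q : edge srv req | (q.2 \in rs) && (q.1 == e q.2)],
      Mstar = graph_of mtf,
      [/\ partial_inj mtf, (exists psi, potential dist mtf psi), near mtf,
          forall s, (mtf s == None) = (s \notin map e rs) &
          forall s y, mtf s = Some y -> y \in rs],
      uniq (map e rs) /\
      \sum_(x <- rs) dist (e x) x + 2 * weight dist mtf <= \sum_(x <- rs) phi x &
      forall x, x \in rs -> traced (take (index x rs) rs) e m phi psi x].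
Proof.
move=> + run; elim: run => [_|{}rs {}M {}Mstar x f p run IH choice].
  exists (fun=> s0), (fun _ _ => None), (fun=> 0), (fun _ _ => 0), (fun=> None).
  split=> //.
  - split=> //; exists (fun=> 0); split=> //.
  - split=> //; rewrite !big_nil /weight big1 // ; lra.
rewrite rcons_uniq => /andP[xrs urs].
have [e [m [phi [psi [mtf [ME MsE [inj [psi0 pot0] nr fr arr] [ue sum] tr]]]]]] := IH urs.
move: choice; rewrite MsE => choice.
have d0 q : 0 <= (fun q : edge srv req => dist q.1 q.2) q by exact: dist_ge0.
have [nx ff [l [ol lf gE]]] := rm_choice_alist d0 inj pot0 choice.
have [psi1 [pot1 [P3 psi1E]]] := eager_potential pot0 ff.
have ev := is_opt_event pot0 nr pot1 P3 ol lf.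
have pot2 := augment_potential dist_ge0 pot1 P3 psi1E ol.
have [ul al _] := ol.
pose upd (T : Type) (g : req -> T) v := fun z => if z == x then v else g z.
have updE (T : Type) (g : req -> T) v : {in rs, g =1 upd _ g v}.
  by move=> z zrs; rewrite /upd; case: eqP => // zx; rewrite zx (negPf xrs) in zrs.
have updx (T : Type) (g : req -> T) v : upd _ g v x = v by rewrite /upd eqxx.
exists (upd _ e f), (upd _ m mtf), (upd _ phi (walk_cost dist mtf x l)),
  (upd _ psi psi1), (augment mtf x l).
have emap : map (upd _ e f) (rcons rs x) = rcons (map e rs) f.
  rewrite map_rcons updx; congr rcons.
  by apply/esym/eq_in_map => z /(updE _ e f).
split.
- apply/setP => -[s y]; rewrite ME !inE /= mem_rcons inE /upd xpair_eqE.
  case: (eqVneq y x) => [->|_] /=; rewrite ?(negPf xrs) ?andbT ?andbF ?orbF //=.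
- exact: gE.
- split.
  + exact: augment_inj.
  + by exists psi1.
  + exact: augment_near pot0 nr ol.
  + move=> s; rewrite emap mem_rcons inE negb_or -fr.
    have := @augment_free _ _ mtf x l s al.
    have -> : last s l = f by case: l al lf {ol gE ev pot2 ul}.
    case: (augment mtf x l s) => [z|] [h1 h2].
      by apply/esym/negP => /andP[sf /eqP sN]; have := h2 (conj sN sf).
    by have [-> ->] := h1 erefl.
  + move=> s y /augment_Some [->|[s' /arr yrs]]; rewrite mem_rcons inE ?eqxx //.
    by rewrite yrs orbT.
- rewrite emap rcons_uniq ue andbT; split.
    by have := fr f; rewrite ff eqxx => <-.
  rewrite -cats1 !big_cat !big_seq1 /= !updx.
  have -> : \sum_(y <- rs) dist (upd _ e f y) y = \sum_(y <- rs) dist (e y) y.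
    by apply: eq_big_seq => y yrs; rewrite -updE.
  have -> : \sum_(y <- rs) upd _ phi (walk_cost dist mtf x l) y = \sum_(y <- rs) phi y.
    by apply: eq_big_seq => y yrs; rewrite -updE.
  have := weight_augment dist x ul al.
  have := dist_le_walk_length x f al; rewrite lf.
  lra.
- move=> y; rewrite mem_rcons inE => /orP[/eqP ->|yrs].
    have -> : take (index x (rcons rs x)) (rcons rs x) = rs.
      by rewrite -cats1 index_cat (negPf xrs) /= eqxx addn0 take_size_cat.
    split; rewrite ?updx //.
    move=> s; rewrite fr; congr (_ \notin _).
    by apply/eq_in_map => z /(updE _ e f).
  have -> : take (index y (rcons rs x)) (rcons rs x) = take (index y rs) rs.
    by rewrite -cats1 index_cat yrs takel_cat // ltnW // index_mem.
  have := tr y yrs.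
  apply: traced_eq_in; rewrite -?updE //.
  by move=> z /mem_take zrs; rewrite -updE.
Qed.

End Line.

(** * One scale of a laminar family of gaps *)

Section Scales.
Variables (R : realFieldType) (n : nat).
Implicit Types (i j t e : 'I_n) (D : R).

Definition lipschitz1 (u : R -> R) := forall a b, `|u a - u b| <= `|a - b|.

Lemma lipschitz1_dist m : lipschitz1 (fun a => `|a - m|).
Proof.
move=> a b; apply: le_trans (ler_dist_dist _ _) _.
by rewrite le_eqVlt; apply/orP; left; apply/eqP; congr `|_|; lra.
Qed.

Lemma lipschitz1_tent A B :
  lipschitz1 (fun a => Num.max 0 (Num.min (a - A) (B - a))).
Proof.
move=> a b; rewrite ler_norml.
have h1 := ler_norm (a - b); have := ler_norm (- (a - b)); rewrite normrN => h2.
rewrite /Num.max /Num.min; do ![case: ifPn; rewrite -?leNgt] => *; apply/andP; split; lra.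
Qed.

(** [alpha i] and [beta i] are the ends of the gap met by request [i], [x i] and [y i] the positions
    of the request and its server, and [O] stands for the optimum. *)
Variables (anc : rel 'I_n) (alpha beta x y phi W : 'I_n -> R) (O : R).

Let len i : R := beta i - alpha i.
Let c i : R := `|y i - x i|.

Hypothesis anc_refl : reflexive anc.
Hypothesis anc_trans : transitive anc.
Hypothesis anc_le : forall j i, anc j i -> (j <= i)%N.
Hypothesis anc_laminar :
  forall j i i', anc j i -> anc j i' -> (i <= i')%N -> anc i i'.
Hypothesis gap_sub : forall j i, anc j i -> alpha i <= alpha j /\ beta j <= beta i.
Hypothesis gap_disj : forall j i, (j <= i)%N -> ~~ anc j i ->
  beta j <= alpha i \/ beta i <= alpha j.
Hypothesis gap_mem : forall i, alpha i <= x i <= beta i.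
Hypothesis gap_end : forall i, y i = alpha i \/ y i = beta i.
Hypothesis gap_phi : forall i, phi i / 3 <= x i - alpha i /\ phi i / 3 <= beta i - x i.
Hypothesis W_ge0 : forall i, 0 <= W i.
Hypothesis lip_sum : forall u i, lipschitz1 u ->
  `|\sum_(j | anc j i) (u (y j) - u (x j))| <= 7 / 3 * W i.
Hypothesis W_sum : forall E : pred 'I_n,
  (forall i j, E i -> E j -> anc i j -> i = j) -> \sum_(i | E i) W i <= 3 * O.

Definition top D t := (len t < D) && [forall t', anc t t' ==> (len t' < D) ==> (t' == t)].

Lemma top_len D t : top D t -> len t < D.
Proof. by case/andP. Qed.

Lemma top_max D t t' : top D t -> anc t t' -> len t' < D -> t' = t.
Proof.
by case/andP=> _ /forallP /(_ t') /implyP h /h /implyP h' /h' /eqP.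
Qed.

Lemma len_anc j i : anc j i -> len j <= len i.
Proof. by move=> /gap_sub[]; rewrite /len; lra. Qed.

Lemma top_exists D j : len j < D -> exists2 t, top D t & anc j t.
Proof.
move=> jD; have Pj : anc j j && (len j < D) by rewrite anc_refl.
case: (@arg_maxnP _ j (fun i => anc j i && (len i < D)) (fun i => i : nat) Pj).
move=> t /andP[jt tD] tmax; exists t => //; rewrite /top tD /=.
apply/forallP => t'; apply/implyP => tt'; apply/implyP => t'D.
apply/eqP/val_inj/eqP; rewrite /= eqn_leq (anc_le tt') andbT.
by apply: tmax; rewrite (anc_trans jt tt').
Qed.

Lemma top_uniq D j t t' : top D t -> top D t' -> anc j t -> anc j t' -> t = t'.
Proof.
move=> tt tt' jt jt'; case: (leqP t t') => h.
  by apply/esym/(top_max tt); rewrite ?(anc_laminar jt jt') ?(top_len tt').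
by apply/(top_max tt'); rewrite ?(anc_laminar jt' jt (ltnW h)) ?(top_len tt).
Qed.

Lemma top_antichain D i j : top D i -> top D j -> anc i j -> i = j.
Proof. by move=> ti tj ij; rewrite (top_max ti ij) // top_len. Qed.

(** Gap lengths grow along [anc], so the maximal gaps shorter than [D] partition the requests whose
    gap is shorter than [D]. *)
Lemma sum_tops D (Q : pred 'I_n) (F : 'I_n -> R) :
  \sum_(j | (len j < D) && Q j) F j =
  \sum_(t | top D t) \sum_(j | anc j t && Q j) F j.
Proof.
rewrite (exchange_big_dep (fun j => (len j < D) && Q j)) /=; last first.
  by move=> t j tt /andP[jt ->]; rewrite (le_lt_trans (len_anc jt) (top_len tt)).
apply: eq_bigr => j /andP[jD Qj]; have [t tt jt] := top_exists jD.
rewrite (big_pred1 t) // => t'; rewrite Qj andbT.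
apply/andP/eqP => [[tt' jt']|->//]; exact: top_uniq tt' tt jt' jt.
Qed.

Let q : R := 25 / 24.

(** The sum over one scale inside [e] is the sum over all of [e] minus the sums over the maximal
    gaps shorter than [D] inside it, and [lip_sum] bounds each of these. *)
Lemma scale_block D e : 0 < D -> top (q * D) e ->
  forall Z, Z = W e + \sum_(t | top D t && anc t e) W t ->
  forall u, lipschitz1 u ->
  `|\sum_(i | anc i e && (D <= len i)) (u (y i) - u (x i))| <= 7 / 3 * Z.
Proof.
move=> D0 te Z -> u lu; pose F i := u (y i) - u (x i).
have -> : \sum_(i | anc i e && (D <= len i)) (u (y i) - u (x i)) =
    \sum_(i | anc i e) F i - \sum_(t | top D t && anc t e) \sum_(i | anc i t) F i.
  rewrite [in RHS](bigID (fun i => D <= len i)) /=.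
  suff -> : \sum_(i | anc i e && ~~ (D <= len i)) F i =
      \sum_(t | top D t && anc t e) \sum_(i | anc i t) F i by lra.
  rewrite (eq_bigl (fun i => (len i < D) && anc i e)); last first.
    by move=> i; rewrite -ltNge andbC.
  rewrite sum_tops [in RHS]big_mkcondr; apply: eq_bigr => t tt.
  case: ifPn => te'.
    apply: eq_bigl => i; apply/andP/idP => [[]//|it]; split=> //.
    exact: anc_trans te'.
  rewrite big_pred0 // => i; apply/negP => /andP[it ie].
  case: (leqP t e) => h; first by move: te'; rewrite (anc_laminar it ie).
  (* Here [e] lies under [t], which is shorter than [q * D], so maximality of [e] forces [t = e]. *)
  have et := anc_laminar ie it (ltnW h).
  have tD : len t < q * D by have := top_len tt; rewrite /q; lra.
  by move: te'; rewrite (top_max te et tD) anc_refl.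
apply: le_trans (ler_normB _ _) _; rewrite mulrDr lerD ?lip_sum //.
apply: le_trans (ler_norm_sum _ _ _) _; rewrite mulr_sumr.
by apply: ler_sum => t _; apply: lip_sum.
Qed.

Lemma scale_block_cost D e : 0 < D -> top (q * D) e ->
  forall Z, Z = W e + \sum_(t | top D t && anc t e) W t ->
  \sum_(i | anc i e && (D <= len i) && (c i <= 2 * phi i)) c i
  <= 182 / 3 * Z + 1 / 12 * \sum_(i | anc i e && (D <= len i)) c i.
Proof.
move=> D0 te Z ZE; have Z0 : 0 <= Z.
  by rewrite ZE addr_ge0 // sumr_ge0.
have c0 i : 0 <= c i by apply: normr_ge0.
case: (pickP (fun i => anc i e && (D <= len i))) => [i0 Pi0|none]; last first.
  rewrite big_pred0 => [|i]; last by rewrite none.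
  by rewrite big_pred0 //; lra.
case: (@arg_minnP _ i0 (fun i => anc i e && (D <= len i)) (fun i => i : nat) Pi0).
move=> i1 /andP[i1e Di1] i1min.
pose A := alpha i1; pose B := beta i1.
have DAB : D <= B - A by [].
(* Two disjoint gaps of length at least [D] do not fit into a block shorter than [q * D]. *)
have sub i : anc i e -> D <= len i -> anc i1 i.
  move=> ie Di; apply/negPn/negP => nanc.
  have le1 : (i1 <= i)%N by apply: i1min; rewrite ie.
  have := gap_sub ie; have := gap_sub i1e; have := top_len te.
  have := gap_disj le1 nanc; move: Di Di1; rewrite /len /q; lra.
have geo i : anc i e -> D <= len i ->
    [/\ alpha i <= A, B <= beta i & len i < q * D].
  move=> ie Di; have [h1 h2] := gap_sub (sub i ie Di); split=> //.
  exact: le_lt_trans (len_anc ie) (top_len te).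
(* The first gap (A, B) is nearly the whole block, so an edge that crosses its
   midpoint loses little; all other edges gain their cost. *)
pose u a := `|a - (A + B) / 2|.
(* An edge shorter than [D / 2] stays on one side of the midpoint. A longer one loses at most
   [D / 24], hence at most a twelfth of its cost. *)
have uS i : anc i e -> D <= len i ->
    (if c i < D / 2 then c i else - (1 / 12) * c i) <= u (y i) - u (x i).
  move=> ie Di; have [h1 h2 h3] := geo i ie Di; have := gap_mem i.
  move: h3; rewrite /q /len /u /c => h3 /andP[h4 h5].
  case: (gap_end i) => ->.
    rewrite (ler0_norm (_ : alpha i - x i <= 0)); last by lra.
    rewrite (ler0_norm (_ : alpha i - _ <= 0)); last by lra.
    case: (ger0P (x i - (A + B) / 2)) => h6; case: ifPn; rewrite -?leNgt => h7; lra.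
  rewrite (ger0_norm (_ : 0 <= beta i - x i)); last by lra.
  rewrite (ger0_norm (_ : 0 <= beta i - _)); last by lra.
  case: (ger0P (x i - (A + B) / 2)) => h6; case: ifPn; rewrite -?leNgt => h7; lra.
have lu : lipschitz1 u by apply: lipschitz1_dist.
have lv := lipschitz1_tent A B; set v := fun a => _ in lv.
(* The tent [v] vanishes at the server. The request is at least [phi i / 3 >= c i / 6] away from the
   ends of its gap, which overhang [(A, B)] by less than [D / 24 <= c i / 12]; so its depth in
   [(A, B)] exceeds [c i / 25]. *)
have vS i : anc i e -> D <= len i ->
    (if (D / 2 <= c i) && (c i <= 2 * phi i) then 1 / 25 * c i else 0)
      <= - (v (y i) - v (x i)).
  move=> ie Di; have [h1 h2 h3] := geo i ie Di.
  have vy : v (y i) = 0.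
    rewrite /v; apply/max_idPl; rewrite ge_min.
    by case: (gap_end i) => ->; apply/orP; [left|right]; lra.
  rewrite vy sub0r opprK; case: ifPn => [/andP[h4 h5]|_]; last first.
    by rewrite /v le_max lexx.
  rewrite /v le_max le_min; apply/orP; right.
  have [h6 h7] := gap_phi i; have /andP[h8 h9] := gap_mem i.
  have ci : c i <= len i.
    rewrite /c; case: (gap_end i) => ->; rewrite /len ler_norml; apply/andP; split; lra.
  by move: h3 h4 h5 ci; rewrite /q /len => h3 h4 h5 ci; apply/andP; split; lra.
have := scale_block D0 te ZE lu; have := scale_block D0 te ZE lv.
rewrite !ler_norml => /andP[hv _] /andP[_ hu].
have {}hu : \sum_(i | anc i e && (D <= len i))
    (if c i < D / 2 then c i else - (1 / 12) * c i) <= 7 / 3 * Z.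
  by apply: le_trans hu; apply: ler_sum => i /andP[]; apply: uS.
have {}hv : \sum_(i | anc i e && (D <= len i))
    (if (D / 2 <= c i) && (c i <= 2 * phi i) then 1 / 25 * c i else 0) <= 7 / 3 * Z.
  apply: (@le_trans _ _ (- \sum_(i | anc i e && (D <= len i)) (v (y i) - v (x i)))); last by lra.
  by rewrite -sumrN; apply: ler_sum => i /andP[]; apply: vS.
(* One bound [7 / 3 * Z] comes from [u], and 25 of them from [v], to undo the factor [1 / 25]. *)
have -> : 182 / 3 * Z = 7 / 3 * Z + 25 * (7 / 3 * Z) by lra.
rewrite big_mkcondr /=.
suff : \sum_(i | anc i e && (D <= len i)) (if c i <= 2 * phi i then c i else 0)
  <= \sum_(i | anc i e && (D <= len i)) (if c i < D / 2 then c i else - (1 / 12) * c i)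
   + 25 * \sum_(i | anc i e && (D <= len i))
    (if (D / 2 <= c i) && (c i <= 2 * phi i) then 1 / 25 * c i else 0)
   + 1 / 12 * \sum_(i | anc i e && (D <= len i)) c i by lra.
rewrite !mulr_sumr -!big_split /=; apply: ler_sum => i _.
have := c0 i; case: (ltP (c i) (D / 2)) => _ ci; case: ifPn => /= _; lra.
Qed.

(** The constant is [364 = 6 * 182 / 3]: the maximal gaps shorter than [q * D] and those shorter
    than [D] are antichains, and each contributes [3 * O]. *)
Lemma scale_cost D : 0 < D ->
  \sum_(i | (D <= len i < q * D) && (c i <= 2 * phi i)) c i
  <= 364 * O + 1 / 12 * \sum_(i | D <= len i < q * D) c i.
Proof.
move=> D0.
have spl (Q : pred 'I_n) : \sum_(i | (D <= len i < q * D) && Q i) c i =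
    \sum_(e | top (q * D) e) \sum_(i | anc i e && (D <= len i) && Q i) c i.
  rewrite (eq_bigl (fun i => (len i < q * D) && ((D <= len i) && Q i))); last first.
    by move=> i; rewrite andbCA andbA.
  by rewrite sum_tops; apply: eq_bigr => e _; apply: eq_bigl => i; rewrite andbA.
rewrite spl.
have -> : \sum_(i | D <= len i < q * D) c i =
    \sum_(e | top (q * D) e) \sum_(i | anc i e && (D <= len i)) c i.
  rewrite (eq_bigl (fun i => (D <= len i < q * D) && true)); last by move=> i; rewrite andbT.
  by rewrite (spl xpredT); apply: eq_bigr => e _; apply: eq_bigl => i; rewrite andbT.
pose Z e := W e + \sum_(t | top D t && anc t e) W t.
have ZO : \sum_(e | top (q * D) e) Z e <= 6 * O.
  rewrite big_split /=.
  have h1 : \sum_(e | top (q * D) e) W e <= 3 * O.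
    by apply: W_sum => i j; apply: top_antichain.
  have h2 : \sum_(t | top D t) W t <= 3 * O.
    by apply: W_sum => i j; apply: top_antichain.
  suff : \sum_(e | top (q * D) e) \sum_(t | top D t && anc t e) W t
      = \sum_(t | top D t) W t by lra.
  rewrite [RHS](eq_bigl (fun t => (len t < q * D) && top D t)).
    by rewrite [RHS]sum_tops; apply: eq_bigr => e _; apply: eq_bigl => t; rewrite andbC.
  move=> t; rewrite andb_idl // => /top_len tD; rewrite /q; lra.
apply: (@le_trans _ _ (\sum_(e | top (q * D) e)
   (182 / 3 * Z e + 1 / 12 * \sum_(i | anc i e && (D <= len i)) c i))).
  by apply: ler_sum => e te; apply: scale_block_cost.
rewrite big_split /= -!mulr_sumr; lra.
Qed.

(** Below [D] there are at most [n] edges, each shorter than [D]; every further scale adds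
    [364 * O]. *)
Lemma scales_cost D K : 0 < D ->
  \sum_(i | (len i < D * q ^+ K) && (c i <= 2 * phi i)) c i
  <= n%:R * D + 364 * K%:R * O + 1 / 12 * \sum_(i | len i < D * q ^+ K) c i.
Proof.
have q0 : 0 < q by rewrite /q; lra.
move=> D0; elim: K => [|K IH].
  rewrite expr0 mulr1 mulr0 mul0r addr0 -[leLHS]addr0 lerD //; last first.
    by apply: mulr_ge0; [lra|apply: sumr_ge0 => i _; apply: normr_ge0].
  apply: (@le_trans _ _ (\sum_(i < n) D)); last first.
    by rewrite sumr_const card_ord mulr_natl.
  rewrite [leRHS](bigID (fun i => (len i < D) && (c i <= 2 * phi i))) /=.
  rewrite -[leLHS]addr0 lerD ?sumr_ge0 // => [|i _]; last exact: ltW.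
  apply: ler_sum => i /andP[iD _]; apply: le_trans (ltW iD).
  have := gap_mem i; rewrite /c /len ler_norml.
  by case: (gap_end i) => -> /andP[? ?]; apply/andP; split; lra.
have qK : 0 < D * q ^+ K by rewrite mulr_gt0 // exprn_gt0.
have spl (Q : pred 'I_n) : \sum_(i | (len i < D * q ^+ K.+1) && Q i) c i =
    \sum_(i | (len i < D * q ^+ K) && Q i) c i +
    \sum_(i | (D * q ^+ K <= len i < q * (D * q ^+ K)) && Q i) c i.
  rewrite exprS mulrCA (bigID (fun i => len i < D * q ^+ K)) /=; congr (_ + _).
    apply: eq_bigl => i; case: (ltP (len i) (D * q ^+ K)) => h; last by rewrite andbF.
    rewrite andbT (lt_trans h) //; move: qK h; rewrite /q => *; lra.
  by apply: eq_bigl => i; rewrite -leNgt; case: (D * _ <= _); rewrite ?andbF ?andbT.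
have h1 := scale_cost qK; rewrite spl.
have := spl xpredT.
rewrite (eq_bigl (fun i => len i < D * q ^+ K.+1)); last by move=> i; rewrite andbT.
rewrite [X in X + _](eq_bigl (fun i => len i < D * q ^+ K)); last by move=> i; rewrite andbT.
rewrite [X in _ + X](eq_bigl (fun i => D * q ^+ K <= len i < q * (D * q ^+ K))); last by move=> i; rewrite andbT.
move=> ->; rewrite -natr1; lra.
Qed.

End Scales.

(** * Gaps, duality and the compressed line *)

Lemma not_same_side_le (R : realFieldType) (c a b : R) :
  ~~ same_side c a b -> `|c - b| <= `|a - b|.
Proof.
case: (eqVneq a c) => [->//|ac]; apply: contraR; rewrite -ltNge => /ltW.
exact: near_same_side.
Qed.

(* Shortens the empty stretches to length cap, so that the scales of the gaps
   span a polynomial range. *)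
Lemma compress_line (R : realFieldType) (cap : R) (l : seq R) : 0 <= cap ->
  exists kappa : R -> R,
    (forall a b, a \in l -> b \in l -> a <= b ->
       Num.min (b - a) cap <= kappa b - kappa a <= b - a) /\
    (forall a, a \in l -> 0 <= kappa a <= (size l)%:R * cap).
Proof.
move=> cap0.
suff sort_case (s : seq R) : path.sorted (fun a b => b <= a) s ->
  exists kappa : R -> R,
    (forall a b, a \in s -> b \in s -> a <= b ->
       Num.min (b - a) cap <= kappa b - kappa a <= b - a) /\
    (forall a, a \in s -> 0 <= kappa a <= (size s)%:R * cap).
  have [|k [h1 h2]] := sort_case (path.sort (fun a b => b <= a) l).
    by apply: path.sort_sorted => a b; apply: le_total.
  exists k; split=> [a b al bl|a al].
    by apply: h1; rewrite path.mem_sort.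
  by move: (h2 a); rewrite path.mem_sort path.size_sort; apply.
elim: s => [|m s IH] srt; first by exists (fun=> 0).
have [k [h1 h2]] := IH (path.path_sorted srt).
have ms a : a \in s -> a <= m.
  move: srt => /= /(path.order_path_min (fun a b c => fun h h' => le_trans h' h)).
  by move=> /allP h /h.
have sz : (size (m :: s))%:R * cap = (size s)%:R * cap + cap.
  by rewrite /= -natr1 mulrDl mul1r.
have szc : 0 <= (size s)%:R * cap by rewrite mulr_ge0 ?ler0n.
case: s => [|p s] in srt IH h1 h2 ms sz szc *.
  exists (fun=> 0); split=> [a b|a _]; last by rewrite sz; apply/andP; split; lra.
  rewrite !inE => /eqP -> /eqP -> _; rewrite !subrr lexx andbT ge_min lexx //.
have pm : p <= m by apply: ms; rewrite mem_head.
have sp a : a \in p :: s -> a <= p.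
  rewrite inE => /orP[/eqP -> //|].
  move: srt => /= /andP[_] /(path.order_path_min (fun a b c => fun h h' => le_trans h' h)).
  by move=> /allP h /h.
(* The list is sorted downwards, so [m] is the largest point and [p] the next one; [m] is placed
   after [p] at the truncated distance. *)
pose k' a := if a \in p :: s then k a else k p + Num.min (m - p) cap.
have kp a : a \in p :: s -> Num.min (p - a) cap <= k p - k a <= p - a.
  by move=> as'; apply: h1; rewrite ?mem_head ?sp.
exists k'; split.
- move=> a b; rewrite !(in_cons m) /k'.
  case as': (a \in p :: s); case bs: (b \in p :: s); rewrite ?orbF ?orbT.
  + by move=> _ _; apply: h1.
  + move=> _ /eqP -> _; have := kp a as'; have := sp a as'.
    rewrite /Num.min; do ![case: ifPn; rewrite -?leNgt] => * ; apply/andP; split; lra.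
  + move=> /eqP am _ ab; have bp := sp b bs.
    have : a = p by apply/eqP; rewrite eq_le (le_trans ab bp) am pm.
    by move=> ap; rewrite ap mem_head in as'.
  + by move=> /eqP -> /eqP -> _; rewrite !subrr lexx andbT ge_min lexx.
- move=> a _; rewrite /k' sz; case: ifPn => [/h2 /andP[? ?]|_].
    by apply/andP; split; lra.
  have /andP[? ?] := h2 p (mem_head _ _).
  by rewrite /Num.min; case: ifPn; rewrite -?leNgt => *; apply/andP; split; lra.
Qed.

(* Server positions are indexed by the request they are matched to online, so
   the servers free when request i arrives are those of index at least i. The
   offline matching met by i pairs the server of index k < i with request
   [pi i k]. *)
Section Process.
Variables (R : realFieldType) (n : nat) (X Y phi : 'I_n -> R).
Variables (pi : 'I_n -> 'I_n -> 'I_n) (psi : 'I_n -> 'I_n -> R) (o : 'I_n -> 'I_n).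
Implicit Types i j k f : 'I_n.

Hypothesis Y_inj : injective Y.
Hypothesis pi_inj : forall i, injective (pi i).
Hypothesis pi_lt : forall i k, (pi i k < i)%N = (k < i)%N.
Hypothesis psi_ge0 : forall i k, 0 <= psi i k.
Hypothesis psi_free : forall i k, (i <= k)%N -> psi i k = 0.
Hypothesis psi_pot : forall i k f, (k < i)%N ->
  psi i k + `|Y k - X (pi i k)| <= psi i f + 3 * `|Y f - X (pi i k)|.
Hypothesis phi_ge0 : forall i, 0 <= phi i.
Hypothesis phi_le : forall i f, phi i <= psi i f + 3 * `|Y f - X i|.
Hypothesis pi_near : forall i k f, (k < i)%N -> (i <= f)%N ->
  `|Y k - X (pi i k)| <= `|Y f - X (pi i k)|.
Hypothesis sideR : forall i f, (i <= f)%N -> X i <= Y f -> Y i <= Y f.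
Hypothesis sideL : forall i f, (i <= f)%N -> Y f <= X i -> Y f <= Y i.
Hypothesis o_inj : injective o.

(* Request j lies in the gap of request i, i.e. no server that is free when i
   arrives separates them. The gaps are laminar as free servers only disappear. *)
Definition anc j i : bool :=
  (j <= i)%N && [forall f : 'I_n, (i <= f)%N ==> same_side (Y f) (X j) (X i)].

Definition gap_weight i : R :=
  \sum_(k : 'I_n | (k < i)%N && anc (pi i k) i) `|Y k - X (pi i k)|.

Definition opt_cost : R := \sum_j `|Y (o j) - X j|.

Lemma ancP j i : reflect ((j <= i)%N /\
  forall f, (i <= f)%N -> same_side (Y f) (X j) (X i)) (anc j i).
Proof.
apply: (iffP andP) => -[ji h]; split=> //.
  by move=> f; apply/implyP; move/forallP: h.
by apply/forallP => f; apply/implyP/h.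
Qed.

Lemma anc_refl : reflexive anc.
Proof. by move=> i; apply/ancP; split=> // f _; apply: same_side_refl. Qed.

Lemma anc_trans : transitive anc.
Proof.
move=> i j k /ancP[ji hj] /ancP[ik hi]; apply/ancP; split.
  exact: leq_trans ik.
by move=> f kf; apply: same_side_trans (hi f kf); apply: hj (leq_trans ik kf).
Qed.

Lemma anc_le j i : anc j i -> (j <= i)%N.
Proof. by case/ancP. Qed.

Lemma anc_laminar j i k : anc j i -> anc j k -> (i <= k)%N -> anc i k.
Proof.
move=> /ancP[ji hi] /ancP[jk hk] ik; apply/ancP; split=> // f kf.
by apply: same_side_trans (hk f kf); rewrite same_side_sym hi // (leq_trans ik).
Qed.

(** [Y i] is the first free server on its side of [X i]. The inequality is strict because [Y i] is
    itself an end of the gap. *)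
Lemma same_side_XY i f : (i < f)%N -> same_side (Y f) (Y i) (X i).
Proof.
move=> lif; have ne : Y i != Y f.
  by apply/eqP => /Y_inj ef; rewrite ef ltnn in lif.
have le := ltnW lif; rewrite /same_side.
case: (ltgtP (X i) (Y f)) => h.
- have yf : Y i < Y f by rewrite lt_neqAle ne sideR // ltW.
  by rewrite yf ltNge (ltW yf).
- have yf : Y f < Y i by rewrite lt_neqAle eq_sym ne sideL // ltW.
  by rewrite yf ltNge (ltW yf).
- by move: ne; rewrite eq_le sideR ?sideL ?h.
Qed.

Lemma same_side_pi i k f : (k < i)%N -> (i <= f)%N ->
  same_side (Y f) (Y k) (X (pi i k)).
Proof.
move=> ki lif; apply: near_same_side (pi_near ki lif).
by apply/eqP => /Y_inj kf; move: ki; rewrite kf ltnNge lif.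
Qed.

(** This is the balance of gaps: neither the online edge of [k] nor the offline edge at [Y k] passes
    a server free at time [i], so [X k], [Y k] and [X (pi i k)] share a gap. *)
Lemma anc_pi i k : (k < i)%N -> anc (pi i k) i = anc k i.
Proof.
move=> ki; rewrite /anc (ltnW ki) (ltnW (_ : pi i k < i)%N) ?pi_lt //=.
apply: eq_forallb => f; case: (leqP i f) => //= lif.
apply/idP/idP; apply: same_side_trans.
  apply: (@same_side_trans _ _ (Y k)); last exact: same_side_pi.
  by rewrite same_side_sym same_side_XY // (leq_trans ki).
apply: (@same_side_trans _ _ (Y k)); last by rewrite same_side_XY // (leq_trans ki).
by rewrite same_side_sym same_side_pi.
Qed.

Lemma sum_pi i (F : 'I_n -> R) :
  \sum_(j : 'I_n | (j < i)%N && anc j i) F j =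
  \sum_(k : 'I_n | (k < i)%N && anc k i) F (pi i k).
Proof.
rewrite (reindex_inj (@pi_inj i)); apply: eq_bigl => k; rewrite pi_lt.
by case ki: (k < i)%N => //=; rewrite anc_pi.
Qed.

Lemma sum_anc i (F : 'I_n -> R) :
  \sum_(j | anc j i) F j = F i + \sum_(j : 'I_n | (j < i)%N && anc j i) F j.
Proof.
rewrite (bigD1 i) ?anc_refl //=; congr (_ + _); apply: eq_bigl => j.
rewrite andbC; case: (boolP (anc j i)) => [/anc_le ji|_]; rewrite ?andbF // !andbT.
by rewrite ltn_neqAle ji andbT.
Qed.

Lemma gap_weightE i :
  gap_weight i = \sum_(k : 'I_n | (k < i)%N && anc k i) `|Y k - X (pi i k)|.
Proof.
by apply: eq_bigl => k; case ki: (k < i)%N => //=; rewrite anc_pi.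
Qed.

Lemma gap_weight_ge0 i : 0 <= gap_weight i.
Proof. by apply: sumr_ge0. Qed.

(** By balance, the earlier servers and requests of the gap can be regrouped along offline edges
    instead of online ones; only the edge of [i] itself is left over. *)
Lemma lip_sum_anc (u : R -> R) i :
  (forall j k, `|u (Y k) - u (X j)| <= `|Y k - X j|) ->
  `|\sum_(j | anc j i) (u (Y j) - u (X j))| <= gap_weight i + `|Y i - X i|.
Proof.
move=> lu; rewrite sum_anc sumrB (sum_pi i (fun j => u (X j))) -sumrB addrC.
apply: le_trans (ler_normD _ _) _; rewrite lerD // gap_weightE.
by apply: le_trans (ler_norm_sum _ _ _) _; apply: ler_sum.
Qed.

(* Each block uses the potential of its own arrival time; this is feasible
   because the servers at the ends of a gap are free and have potential 0. *)
Section GluedDual.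
Variable E : pred 'I_n.
Hypothesis E_antichain : forall i j, E i -> E j -> anc i j -> i = j.

Let block j := [pick i | E i && anc j i].

Let block_Some i j : E i -> anc j i -> block j = Some i.
Proof.
move=> Ei ji; rewrite /block; case: pickP => [i' /andP[Ei' ji']|/(_ i)]; last by rewrite Ei ji.
congr Some; case: (leqP i i') => h.
  by apply/esym/E_antichain => //; apply: anc_laminar ji ji' h.
by apply: E_antichain => //; apply: anc_laminar ji' ji (ltnW h).
Qed.

Let block_anc i j : block j = Some i -> E i /\ anc j i.
Proof. by rewrite /block; case: pickP => // i' /andP[? ?] [<-]. Qed.

(** The dual value of request [j] at the arrival of [i]: for an earlier request it is read off from
    its offline partner. *)
Let value i j : R := if j == i then phi i else
  let k := invF (@pi_inj i) j in psi i k + `|Y k - X j|.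

Let value_le i j f : (j <= i)%N -> value i j <= psi i f + 3 * `|Y f - X j|.
Proof.
rewrite /value leq_eqVlt; case: (eqVneq j i) => [-> _|ji /=].
  exact: phi_le.
rewrite (negPf (_ : (j != i :> nat))) //= => lt.
set k := invF _ _; have kj : pi i k = j by rewrite /k f_invF.
have ki : (k < i)%N by rewrite -(pi_lt i) kj.
by have := psi_pot f ki; rewrite kj.
Qed.

Let dualX j : R := if block j is Some i then value i j else 0.
Let dualY k : R := if block k is Some i then psi i k else 0.

Let sum_block (F : 'I_n -> 'I_n -> R) :
  \sum_j (if block j is Some i then F i j else 0) =
  \sum_(i | E i) \sum_(j | anc j i) F i j.
Proof.
rewrite (exchange_big_dep predT) //=; apply: eq_bigr => j _.
case Eb: (block j) => [i|].
  have [Ei ji] := block_anc Eb.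
  rewrite (big_pred1 i) // => i'; apply/andP/eqP => [[Ei' ji']|->//].
  by move: (block_Some Ei' ji'); rewrite Eb => -[].
rewrite big_pred0 // => i; apply/negP => /andP[Ei ji].
by rewrite (block_Some Ei ji) in Eb.
Qed.

(** If [k] lies outside the block of [j], then either [Y k] is still free and has potential 0, or a
    free server separates it from [X j]. That server is nearer to [X j] and has potential 0. *)
Let dual_feasible j k : dualX j - dualY k <= 3 * `|Y k - X j|.
Proof.
have dY0 : 0 <= dualY k by rewrite /dualY; case: (block k).
rewrite /dualX; case Eb: (block j) => [i|]; last by have := normr_ge0 (Y k - X j); lra.
have [Ei /ancP[ji hj]] := block_anc Eb.
case ki: (anc k i); first by have := value_le k ji; rewrite /dualY (block_Some Ei ki); lra.
case: (leqP i k) => lik.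
  by have := value_le k ji; rewrite psi_free //; lra.
have : exists2 f : 'I_n, (i <= f)%N & ~~ same_side (Y f) (X k) (X i).
  move: ki; rewrite /anc (ltnW lik) /= => /negbT; rewrite negb_forall.
  by case/existsP => f; rewrite negb_imply => /andP[? ?]; exists f.
case=> f lif ns; have := value_le f ji; rewrite psi_free //.
have : `|Y f - X j| <= `|Y k - X j|; last by lra.
apply: not_same_side_le; apply: contra ns => h.
apply: (same_side_trans (b := Y k)).
  by rewrite same_side_sym same_side_XY // (leq_trans lik).
exact: same_side_trans h (hj f lif).
Qed.

(** Within a block the potentials of matched pairs cancel, leaving the offline weight plus [phi i].
    Weak duality along the matching [o] gives the bound, the factor 3 being that of the dual
    constraints. *)
Lemma antichain_sum : \sum_(i | E i) (gap_weight i + phi i) <= 3 * opt_cost.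
Proof.
apply: (@le_trans _ _ (\sum_j dualX j - \sum_k dualY k)).
  rewrite !sum_block -sumrB; apply: ler_sum => i Ei.
  rewrite !sum_anc psi_free // {1}/value eqxx gap_weightE.
  rewrite (sum_pi i (value i)).
  have -> : \sum_(k : 'I_n | (k < i)%N && anc k i) value i (pi i k) =
      \sum_(k : 'I_n | (k < i)%N && anc k i) (psi i k + `|Y k - X (pi i k)|).
    apply: eq_bigr => k /andP[ki _]; rewrite /value.
    case: (eqVneq (pi i k) i) => [pk|_] /=; last by rewrite invF_f.
    by move: ki; rewrite -(pi_lt i) pk ltnn.
  by rewrite big_split /=; lra.
rewrite [X in _ - X](reindex_inj o_inj) -sumrB /opt_cost mulr_sumr.
by apply: ler_sum => j _; apply: dual_feasible.
Qed.

End GluedDual.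

Hypothesis cost_le : forall i, `|Y i - X i| <= 4 / 3 * (gap_weight i + phi i).
Hypothesis cost_sum : \sum_i `|Y i - X i| <= \sum_i phi i.

Let W i : R := gap_weight i + phi i.

Let W_ge0 i : 0 <= W i.
Proof. by rewrite addr_ge0 ?gap_weight_ge0. Qed.

Let W_le i : W i <= 3 * opt_cost.
Proof.
have := @antichain_sum (pred1 i); rewrite big_pred1_eq; apply.
by move=> j k /eqP -> /eqP ->.
Qed.

(** * Transfer of the scale bound to the compressed line *)

Section Compressed.
Variables (kappa : R -> R) (B : R).
(** Large enough to preserve every online edge, since [4 / 3 * W i <= 4 * opt_cost], and to dominate
    every [phi i / 3]. *)
Let cap : R := 4 * opt_cost.
Let pos (a : R) : Prop := (exists i, a = X i) \/ (exists i, a = Y i).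

Hypothesis kappa_dist : forall a b, pos a -> pos b -> a <= b ->
  Num.min (b - a) cap <= kappa b - kappa a <= b - a.
(** The margins of width [cap] keep the artificial gap ends [0] and [B] at distance at least
    [phi i / 3] from every request. *)
Hypothesis kappa_bound : forall a, pos a -> cap <= kappa a <= B - cap.

Let x i := kappa (X i).
Let y i := kappa (Y i).

(* The compressed position of the nearest free server on each side, with the
   ends 0 and B standing for a missing one. *)
Let alpha i := \big[Num.max/0]_(f : 'I_n | (i <= f)%N && (Y f <= X i)) y f.
Let beta i := \big[Num.min/B]_(f : 'I_n | (i <= f)%N && (X i <= Y f)) y f.

Let posX i : pos (X i). Proof. by left; exists i. Qed.
Let posY i : pos (Y i). Proof. by right; exists i. Qed.
Let cap_ge0 : 0 <= cap.
Proof. by rewrite mulr_ge0 ?sumr_ge0. Qed.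

Let kappa_mono a b : pos a -> pos b -> a <= b -> kappa a <= kappa b.
Proof.
move=> pa pb ab; have /andP[+ _] := kappa_dist pa pb ab.
rewrite ge_min => /orP[]; have := cap_ge0; lra.
Qed.

Let kappa_lip a b : pos a -> pos b -> `|kappa a - kappa b| <= `|a - b|.
Proof.
move=> pa pb; wlog ab : a b pa pb / a <= b => [H|].
  case: (leP a b) => [/H|/ltW /H h]; first exact.
  by rewrite distrC [leRHS]distrC h.
rewrite distrC [leRHS]distrC (ger0_norm (_ : 0 <= b - a)) ?subr_ge0 //.
rewrite (ger0_norm (_ : 0 <= kappa b - _)) ?subr_ge0 ?kappa_mono //.
by have /andP[] := kappa_dist pa pb ab.
Qed.

Let kappa_iso a b : pos a -> pos b -> `|a - b| <= cap ->
  `|kappa a - kappa b| = `|a - b|.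
Proof.
move=> pa pb; wlog ab : a b pa pb / a <= b => [H abc|].
  case: (leP a b) => [/H|/ltW /H h]; first exact.
  by rewrite distrC [RHS]distrC; apply: h; rewrite // distrC.
rewrite distrC [`|kappa a - _|]distrC.
rewrite (ger0_norm (_ : 0 <= b - a)) ?subr_ge0 // => abc.
rewrite (ger0_norm (_ : 0 <= kappa b - _)) ?subr_ge0 ?kappa_mono //.
have /andP[+ h] := kappa_dist pa pb ab; rewrite ge_min => /orP[]; lra.
Qed.

Let alpha_ge i f : (i <= f)%N -> Y f <= X i -> y f <= alpha i.
Proof. by move=> h1 h2; apply: le_bigmax_cond; rewrite h1. Qed.

Let beta_le i f : (i <= f)%N -> X i <= Y f -> beta i <= y f.
Proof. by move=> h1 h2; apply: bigmin_le_cond; rewrite h1. Qed.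

Let y_bound i : cap <= y i <= B - cap. Proof. exact: kappa_bound. Qed.
Let x_bound i : cap <= x i <= B - cap. Proof. exact: kappa_bound. Qed.

Let gap_mem i : alpha i <= x i <= beta i.
Proof.
have /andP[h1 h2] := x_bound i; have := cap_ge0 => h3; apply/andP; split.
  apply: bigmax_le => [|f /andP[lif h]]; first by lra.
  exact: kappa_mono.
apply: le_bigmin => [|f /andP[lif h]]; first by lra.
exact: kappa_mono.
Qed.

Let gap_end i : y i = alpha i \/ y i = beta i.
Proof.
have /andP[h1 h2] := y_bound i; have := cap_ge0 => h3.
case: (leP (Y i) (X i)) => h; [left|right]; apply/eqP; rewrite eq_le.
  rewrite alpha_ge //=; apply: bigmax_le => [|f /andP[lif hf]]; first by lra.
  by apply: kappa_mono => //; apply: sideL.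
rewrite [X in _ && X]beta_le ?andbT ?(ltW h) //.
apply: le_bigmin => [|f /andP[lif hf]]; first by lra.
by apply: kappa_mono => //; apply: sideR.
Qed.

Let gap_sub j i : anc j i -> alpha i <= alpha j /\ beta j <= beta i.
Proof.
case/ancP => ji h; split.
  apply: bigmax_le => [|f /andP[lif hf]].
    exact: bigmax_ge_id.
  apply: alpha_ge; first exact: leq_trans lif.
  by have /andP[/eqP e _] := h f lif; rewrite leNgt e -leNgt.
apply: le_bigmin => [|f /andP[lif hf]].
  exact: bigmin_le_id.
apply: beta_le; first exact: leq_trans lif.
by have /andP[_ /eqP e] := h f lif; rewrite leNgt e -leNgt.
Qed.

Let gap_disj j i : (j <= i)%N -> ~~ anc j i -> beta j <= alpha i \/ beta i <= alpha j.
Proof.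
move=> ji; rewrite /anc ji negb_forall => /existsP[f]; rewrite negb_imply.
case/andP => lif; have ljf := leq_trans ji lif.
case: (leP (X j) (Y f)) => h1; case: (leP (Y f) (X i)) => h2.
- by move=> _; left; apply: le_trans (beta_le ljf h1) (alpha_ge lif h2).
- case: (leP (Y f) (X j)) => h3.
    by move=> _; right; apply: le_trans (beta_le lif (ltW h2)) (alpha_ge ljf h3).
  by rewrite /same_side h2 h3 ltNge (ltW h3) ltNge (ltW h2).
- case: (leP (X i) (Y f)) => h3.
    by move=> _; right; apply: le_trans (beta_le lif h3) (alpha_ge ljf (ltW h1)).
  by rewrite /same_side h1 h3 ltNge (ltW h1) ltNge (ltW h3).
- by move=> _; right; apply: le_trans (beta_le lif (ltW h2)) (alpha_ge ljf (ltW h1)).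
Qed.

Let phi_cap i : phi i / 3 <= cap.
Proof. by have := W_le i; have := gap_weight_ge0 i; have := cap_ge0; rewrite /W /cap; lra. Qed.

Let phi_near i f : (i <= f)%N -> phi i / 3 <= `|Y f - X i|.
Proof. by move=> lif; have := phi_le i f; rewrite psi_free //; lra. Qed.

(** The direct walk to a free server shows that its distance is at least [phi i / 3]; this survives
    compression because [phi i / 3 <= cap]. *)
Let gap_phi i : phi i / 3 <= x i - alpha i /\ phi i / 3 <= beta i - x i.
Proof.
have /andP[h1 h2] := x_bound i; have h3 := phi_cap i; split.
  suff : alpha i <= x i - phi i / 3 by lra.
  apply: bigmax_le => [|f /andP[lif hf]]; first by lra.
  have /andP[+ _] := kappa_dist (posY f) (posX i) hf.
  have := phi_near lif; rewrite distrC ger0_norm ?subr_ge0 // /x /y => h4.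
  by rewrite ge_min => /orP[]; lra.
suff : x i + phi i / 3 <= beta i by lra.
apply: le_bigmin => [|f /andP[lif hf]]; first by lra.
have /andP[+ _] := kappa_dist (posX i) (posY f) hf.
have := phi_near lif; rewrite ger0_norm ?subr_ge0 // /x /y => h4.
by rewrite ge_min => /orP[]; lra.
Qed.

Let cost_iso i : `|y i - x i| = `|Y i - X i|.
Proof.
apply: kappa_iso => //; apply: le_trans (cost_le i) _.
have := W_le i; rewrite /W /cap; lra.
Qed.

(** Here [7 / 3 = 1 + 4 / 3]: offline weight in the gap plus the online edge of [i]. *)
Let lip_sum (u : R -> R) i : lipschitz1 u ->
  `|\sum_(j | anc j i) (u (y j) - u (x j))| <= 7 / 3 * W i.
Proof.
move=> lu; have := cost_le i.
have := @lip_sum_anc (u \o kappa) i; rewrite /= => h.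
have {}h := h (fun j k => le_trans (lu _ _) (kappa_lip (posY k) (posX j))).
by move: h; rewrite /W /x /y; have := gap_weight_ge0 i; have := phi_ge0 i; lra.
Qed.

Lemma compressed_cost D K : 0 < D -> B < D * (25 / 24) ^+ K ->
  \sum_(i | `|Y i - X i| <= 2 * phi i) `|Y i - X i|
  <= n%:R * D + 364 * K%:R * opt_cost + 1 / 12 * \sum_i `|Y i - X i|.
Proof.
move=> D0 BK.
have := @scales_cost R n anc alpha beta x y phi W opt_cost anc_refl anc_trans
  anc_le anc_laminar gap_sub gap_disj gap_mem gap_end gap_phi W_ge0 lip_sum
  antichain_sum D K D0.
have lenB i : beta i - alpha i < D * (25 / 24) ^+ K.
  apply: le_lt_trans BK.
  have : beta i <= B by apply: bigmin_le_id.
  have : 0 <= alpha i by apply: bigmax_ge_id.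
  lra.
have -> : \sum_(i | (beta i - alpha i < D * (25 / 24) ^+ K) &&
      (`|y i - x i| <= 2 * phi i)) `|y i - x i| =
    \sum_(i | `|Y i - X i| <= 2 * phi i) `|Y i - X i|.
  by apply: eq_big => [i|i _]; rewrite ?lenB cost_iso.
have -> // : \sum_(i | beta i - alpha i < D * (25 / 24) ^+ K) `|y i - x i| =
    \sum_i `|Y i - X i|.
by apply: eq_big => [i|i _]; rewrite ?lenB ?cost_iso.
Qed.

End Compressed.

Let pos_seq := codom X ++ codom Y.

Lemma process_cost_scales D K : 0 < D ->
  8 * (n%:R + 1) * opt_cost < D * (25 / 24) ^+ K ->
  \sum_i `|Y i - X i| <= 9 * (n%:R * D + 364 * K%:R * opt_cost).
Proof.
move=> D0 BK; set T := \sum_i _.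
have opt0 : 0 <= 4 * opt_cost by rewrite mulr_ge0 ?sumr_ge0.
have [kap [kd kb]] := compress_line pos_seq opt0.
have mem a : (exists i, a = X i) \/ (exists i, a = Y i) -> a \in pos_seq.
  by case=> -[i ->]; rewrite mem_cat codom_f ?orbT.
(* The [2n] points span at most [2n] times [4 * opt_cost], and two margins of [4 * opt_cost] are
   added. *)
have := @compressed_cost (fun a => 4 * opt_cost + kap a)
  (8 * (n%:R + 1) * opt_cost) _ _ D K D0 BK.
set S := \sum_(i | _) _ => h.
have {}h : S <= n%:R * D + 364 * K%:R * opt_cost + 1 / 12 * T.
  apply: h => [a b /mem pa /mem pb ab|a /mem pa].
    have := kd a b pa pb ab.
    by rewrite (_ : 4 * opt_cost + kap b - _ = kap b - kap a); last by lra.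
  have := kb a pa; rewrite size_cat !size_codom card_ord natrD.
  by move=> /andP[? ?]; apply/andP; split; lra.
(* Edges with [c <= 2 * phi] have [phi <= 3 * c], the others [phi < c / 2]. So
   [T <= 3 * S + (T - S) / 2], that is [T <= 5 * S]; absorbing [5 / 12 * T] leaves the factor
   [60 / 7 <= 9]. *)
suff : T <= 5 * S.
  have : 0 <= n%:R * D + 364 * K%:R * opt_cost.
    by rewrite addr_ge0 ?mulr_ge0 ?ler0n ?sumr_ge0 ?(ltW D0).
  lra.
have c3 i : phi i <= 3 * `|Y i - X i| by have := phi_le i i; rewrite psi_free //; lra.
have := cost_sum; rewrite -/T.
have TE : T = S + \sum_(i | ~~ (`|Y i - X i| <= 2 * phi i)) `|Y i - X i|.
  by rewrite /T (bigID (fun i => `|Y i - X i| <= 2 * phi i)).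
rewrite (bigID (fun i => `|Y i - X i| <= 2 * phi i)) /=.
have : \sum_(i | `|Y i - X i| <= 2 * phi i) phi i <= 3 * S.
  by rewrite mulr_sumr; apply: ler_sum.
have : \sum_(i | ~~ (`|Y i - X i| <= 2 * phi i)) phi i <=
    1 / 2 * \sum_(i | ~~ (`|Y i - X i| <= 2 * phi i)) `|Y i - X i|.
  by rewrite mulr_sumr; apply: ler_sum => i; rewrite -ltNge; lra.
move: TE; lra.
Qed.

End Process.

(** * Logarithmically many scales *)

Lemma cost_graph (srv req : finType) (R : realType) (d : edge srv req -> R)
    (g : req -> srv) (M : {set edge srv req}) :
  (forall q, (q \in M) = (q.1 == g q.2)) -> cost d M = \sum_y d (g y, y).
Proof.
move=> MP; rewrite /cost (_ : M = [set (g y, y) | y in predT]).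
  by rewrite big_imset //= => y z _ _ [].
apply/setP => -[s y]; rewrite MP /=; apply/eqP/imsetP => [->|[z _ [-> ->]] //].
by exists y.
Qed.

Lemma perfect_matching_graph (srv req : finType) (R : realType)
    (d : edge srv req -> R) (M : {set edge srv req}) :
  perfect_matching M ->
  exists g : req -> srv, injective g /\ cost d M = \sum_y d (g y, y).
Proof.
case=> mM cov.
have ex y : exists s, (s, y) \in M.
  have /existsP[[s z] /andP[Ms]] := cov (inr y).
  by rewrite /incident /= => /eqP[yz]; exists s; rewrite yz.
have [g gM] := fin_all_exists ex.
exists g; split=> [y z gyz|].
  have := @mM (g y, y) (g z, z) (inl (g y)) (gM y) (gM z).
  by rewrite /incident /= gyz eqxx => /(_ erefl erefl) [].
apply: cost_graph => -[s y] /=; apply/idP/eqP => [sM|->]; last exact: gM.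
have := mM _ _ (inr y) sM (gM y).
by rewrite /incident /= eqxx => /(_ erefl erefl) [].
Qed.

Lemma bernoulli_le (R : realFieldType) (a : R) k : 0 <= a ->
  1 + k%:R * a <= (1 + a) ^+ k.
Proof.
move=> a0; elim: k => [|k IH]; first by rewrite expr0; lra.
rewrite exprS -natr1.
have : (1 + a) * (1 + k%:R * a) <= (1 + a) * (1 + a) ^+ k.
  by rewrite ler_wpM2l //; lra.
have : 0 <= k%:R * a * a by rewrite !mulr_ge0 ?ler0n.
lra.
Qed.

(* 24 steps of ratio 25/24 at least double a length *)
Lemma enough_scales (R : realFieldType) (n : nat) : (2 <= n)%N ->
  8 * n%:R * (n%:R + 1) < (25 / 24 : R) ^+ (24 * (2 * trunc_log 2 n + 5)).
Proof.
move=> n2; set l := trunc_log 2 n.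
have nl : (n < 2 ^ l.+1)%N by apply: trunc_log_ltn.
apply: (@lt_le_trans _ _ (2 ^+ (2 * l + 5))); last first.
  rewrite exprM; apply: lerXn2r; rewrite ?nnegrE //; first by rewrite exprn_ge0 //; lra.
  have := @bernoulli_le R (1 / 24) 24; rewrite (_ : 1 + 1 / 24 = 25 / 24 :> R); last by lra.
  by move=> h; apply: le_trans (h _); lra.
rewrite natr1 -natrX -!natrM ltr_nat.
rewrite (_ : (2 * l + 5 = 3 + l.+1 + l.+1)%N); last by lia.
rewrite !expnD; nia.
Qed.

(** * The bound for a run of the algorithm *)

Section Competitive.
Variables (R : realType) (n : nat) (s r : 'I_n -> R).
Variables (M Mstar Mopt : {set edge 'I_n 'I_n}).
Hypothesis n_ge2 : (2 <= n)%N.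
Hypothesis s_inj : injective s.
Hypothesis run : rm_run (line_cost s r) 3 (enum 'I_n) M Mstar.
Hypothesis perfect_Mopt : perfect_matching Mopt.

Lemma run_cost_scales D K : 0 < D ->
  8 * (n%:R + 1) * cost (line_cost s r) Mopt < D * (25 / 24) ^+ K ->
  cost (line_cost s r) M <=
  9 * (n%:R * D + 364 * K%:R * cost (line_cost s r) Mopt).
Proof.
have i0 : 'I_n by apply: (@Ordinal n 0); apply: leq_trans n_ge2.
have [e [m [phi [psi [mtf [ME _ [_ _ _ _ _] [ue sum] tr]]]]]] :=
  rm_run_traced s_inj i0 (enum_uniq 'I_n) run.
have e_inj : injective e by apply/injectiveP.
have taken i k : (e k \in map e (take (index i (enum 'I_n)) (enum 'I_n))) = (k < i)%N.
  by rewrite mem_map // in_take ?mem_enum // !index_enum_ord.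
have {}tr i := tr i (mem_enum _ i).
have m_free i k : (m i (e k) == None) = (i <= k)%N.
  by rewrite (traced_free (tr i)) taken -leqNgt.
have m_lt i t j : m i t = Some j -> (j < i)%N.
  move=> /(traced_arrived (tr i)).
  by rewrite -(mem_map e_inj) taken.
have {}tr i := (traced_event (tr i), traced_inj (tr i)).
have [g [g_inj ->]] := perfect_matching_graph (line_cost s r) perfect_Mopt.
have -> : cost (line_cost s r) M = \sum_i `|s (e i) - r i|.
  by apply: cost_graph => -[t j]; rewrite ME inE mem_enum.
pose e' := invF e_inj.
(* The default makes [pi i] the identity on indices of free servers, hence injective on all
   indices. *)
pose pi i k := odflt k (m i (e k)).
have m_Some (i k : 'I_n) : (k < i)%N -> m i (e k) = Some (pi i k).
  by rewrite ltnNge -m_free /pi; case: (m i (e k)).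
have pi_id (i k : 'I_n) : (i <= k)%N -> pi i k = k.
  by rewrite -m_free /pi => /eqP ->.
have pi_lt (i k : 'I_n) : (pi i k < i)%N = (k < i)%N.
  case: (leqP i k) => [ik|ki]; first by rewrite pi_id // ltnNge ik.
  by rewrite (m_lt _ _ _ (m_Some _ _ ki)).
have pi_inj (i : 'I_n) : injective (pi i).
  move=> k k' kk; case: (leqP i k) => ik.
    by rewrite -(pi_id _ _ ik) kk pi_id // leqNgt -pi_lt -kk pi_id // -leqNgt.
  have ik' : (k' < i)%N by rewrite -pi_lt -kk pi_lt.
  apply: (@e_inj); apply: (tr i).2 (m_Some _ _ ik) _.
  by rewrite kk m_Some.
(* Servers are indexed by their online partners, so the optimal matching becomes [e' \o g]. *)
have optE : \sum_j line_cost s r (g j, j) = opt_cost r (s \o e) (e' \o g).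
  by apply: eq_bigr => j _; rewrite /= f_invF.
rewrite optE => D0 DK.
have pot i : potential (dist s r) (m i) (psi i) by case: (tr i) => -[].
apply: (@process_cost_scales R n r (s \o e) phi pi (fun i k => psi i (e k)) (e' \o g))
  D0 DK => //.
- exact: inj_comp.
- by move=> i k; case: (pot i).
- by move=> i k; rewrite -m_free => /eqP; case: (pot i) => _ + _; apply.
- by move=> i k f ki; case: (pot i) => _ _; apply; apply: m_Some.
- by move=> i; apply: event_ge0 (tr i).1.
- by move=> i f; apply: event_le (tr i).1 (e f).
- move=> i k f ki; rewrite -m_free => /eqP; apply: (event_near (tr i).1).
  exact: m_Some.
- by move=> i f; rewrite -m_free => /eqP; apply: (event_sideR (tr i).1).
- by move=> i f; rewrite -m_free => /eqP; apply: (event_sideL (tr i).1).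
- by apply: inj_comp => //; apply: can_inj (f_invF e_inj).
- move=> i; have := event_cost (tr i).1; rewrite /dist /=.
  suff : local_weight s r (m i) i <= gap_weight r (s \o e) pi i by lra.
  rewrite /local_weight /gap_weight (reindex_inj e_inj) /= big_mkcond [leRHS]big_mkcond /=.
  apply: ler_sum => k _; case: (leqP i k) => ik /=.
    by move: ik; rewrite -m_free => /eqP -> /=; case: ifP.
  case: ifPn => [/forallP ins|_]; last by case: ifP.
  rewrite (m_Some _ _ ik) /= ifT // /anc ltnW ?pi_lt //=.
  apply/forallP => f; apply/implyP; rewrite -m_free => ff.
  by have := ins (e f); rewrite ff (m_Some _ _ ik).
- have := sum; rewrite !big_enum /=.
  have : 0 <= weight (dist s r) mtf.
    by apply: sumr_ge0 => t _; apply: pcost_ge0 => *; apply: dist_ge0.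
  rewrite /dist; lra.
Qed.

Lemma run_cost_log : cost (line_cost s r) M <=
  900 * 700 * (trunc_log 2 n)%:R * cost (line_cost s r) Mopt.
Proof.
set opt := cost _ Mopt; set l := trunc_log 2 n.
have opt0 : 0 <= opt by apply: sumr_ge0 => e _; apply: normr_ge0.
have n0 : 0 < n%:R :> R by rewrite ltr0n; apply: leq_trans n_ge2.
have l1 : 1 <= l%:R :> R by rewrite ler1n trunc_log_gt0.
pose q : R := 25 / 24.
have [K KE qK] : exists2 K, K%:R = 24 * (2 * l%:R + 5) :> R &
    8 * n%:R * (n%:R + 1) < q ^+ K.
  exists (24 * (2 * l + 5))%N; last exact: enough_scales.
  by rewrite natrM natrD natrM.
case: (eqVneq opt 0) => [opt_eq0|opt_ne0].
  rewrite opt_eq0 mulr0 leNgt; apply/negP => c0.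
  (* With optimum 0 and no scales, this [D] yields that the cost is at most half of itself. *)
  have D0 : 0 < cost (line_cost s r) M / (18 * n%:R) by rewrite divr_gt0 ?mulr_gt0.
  have := run_cost_scales (K := 0) D0; rewrite -/opt opt_eq0 !mulr0 expr0 mulr1.
  move=> /(_ D0); rewrite addr0.
  rewrite (_ : 9 * (n%:R * _) = cost (line_cost s r) M / 2); first by lra.
  by field; rewrite gt_eqF.
have opt_gt0 : 0 < opt by rewrite lt_neqAle eq_sym opt_ne0.
(* With this smallest scale, the term [n%:R * D] is just [opt]. *)
have D0 : 0 < opt / n%:R by rewrite divr_gt0.
have := run_cost_scales (K := K) D0; rewrite -/opt -/q => h.
have {h}/h : 8 * (n%:R + 1) * opt < opt / n%:R * q ^+ K.
  rewrite [ltRHS]mulrAC ltr_pdivlMr //.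
  rewrite (_ : _ * n%:R = opt * (8 * n%:R * (n%:R + 1))); last by ring.
  by rewrite ltr_pM2l.
rewrite (_ : n%:R * (opt / n%:R) = opt); last by field; rewrite gt_eqF.
rewrite KE => h; apply: le_trans h _.
(* As [l >= 1], the factor is at most [9 * (1 + 364 * 24 * 7) * l], and [9 * (1 + 364 * 24 * 7) =
   550377 <= 900 * 700]. *)
have : opt <= l%:R * opt by rewrite ler_peMl.
lra.
Qed.

End Competitive.

Theorem mainTheorem1 (R : realType) :
  exists C : R, 0 < C /\
    forall (n : nat) (s r : 'I_n -> R)
           (M Mstar Mopt : {set edge 'I_n 'I_n}),
      (2 <= n)%N ->
      injective s ->
      rm_run (line_cost s r) 3 (enum 'I_n) M Mstar ->
      min_cost_perfect_matching (line_cost s r) Mopt ->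
      cost (line_cost s r) M <= C * ln n%:R * cost (line_cost s r) Mopt.
Proof.
have ln2 : 0 < ln 2 :> R by rewrite ln_gt0 // ltr1n.
exists (900 * 700 / ln 2); split; first by rewrite divr_gt0 ?mulr_gt0.
move=> n s r M Mstar Mopt n2 s_inj run [perf _].
apply: le_trans (run_cost_log n2 s_inj run perf) _.
apply: ler_wpM2r; first by apply: sumr_ge0 => e _; apply: normr_ge0.
rewrite -[leRHS]mulrA; apply: ler_wpM2l; first exact: mulr_ge0.
(* What remains is [l * ln 2 <= ln n] for [l = trunc_log 2 n], which is [2 ^ l <= n]. *)
rewrite mulrC ler_pdivlMr //.
rewrite mulr_natl -lnXn // -natrX ler_ln ?posrE ?ltr0n ?expn_gt0 //; last first.
  exact: leq_trans n2.
by rewrite ler_nat trunc_logP // (leq_trans _ n2).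
Qed.
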